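(* Let $n\ge 1$ and let $S$ be a conformal transformation of the sphere $S^n$, identified with an element of $G=O_o(1,n+1)$. Then the Brenier-McCann polar factorization of $S$ coincides with the algebraic polar factorization of $S$. That is, if $S=P\,O$ is the decomposition of $S$ in $G$ with $P\in\exp(\mathfrak{p})$ and $O\in SO(n+1)$, and if $S=T\circ U$ is the (a.e. unique) factorization with $U:S^n\to S^n$ volume preserving and $T:S^n\to S^n$ the optimal transportation map between $\mathrm{vol}_{S^n}$ and $S_{\#}(\mathrm{vol}_{S^n})$, then $T$ and $U$ coincide a.e. with the maps of $S^n$ induced by $P$ and $O$, respectively.
   Context: $S^n$ is the unit sphere centered at the origin of $\mathbb{R}^{n+1}$ with its round metric, Riemannian measure $\mathrm{vol}_{S^n}$ and geodesic distance $d$. Optimal maps: consider the cost $c(p,q)=\frac12 d(p,q)^2$. For a Borel map $F$ and a finite Borel measure $\mu$, $F_{\#}\mu$ is the push-forward, $(F_{\#}\mu)(B)=\mu(F^{-1}(B))$. A (Borel) map $T:S^n\to S^n$ is an optimal transportation map between $\mu$ and $\nu$ if $T_{\#}\mu=\nu$ and $T$ minimizes $\int_{S^n} c(x,T'(x))\,d\mu(x)$ among all maps $T'$ with $T'_{\#}\mu=\nu$. By McCann's theorem, with $\mu=\mathrm{vol}_{S^n}$, a map $S$ of $S^n$ pushing forward $\mu$ to $\nu$ factors uniquely a.e. as $S=T\circ U$ with $U$ volume preserving ($U_{\#}\mu=\mu$) and $T$ the optimal transportation map between $\mu$ and $\nu$; this is the Brenier-McCann polar factorization of $S$. Conformal transformations: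 for $n\ge 2$, a conformal transformation of $S^n$ is an orientation preserving diffeomorphism $F$ of $S^n$ with $F^*g=fg$ for some positive function $f$, where $g$ is the round metric. Let $G=O_o(1,n+1)$ be the identity component of the group of linear automorphisms of $\mathbb{R}^{n+2}=\mathbb{R}\times\mathbb{R}^{n+1}$ preserving the symmetric bilinear form of signature $(1,n+1)$ (standard Lorentz form). $G$ acts on $S^n$: for $A\in G$ and $u\in S^n$, $A\cdot u$ is the unique $u'\in S^n$ such that $A\begin{pmatrix} 1 \\ u \end{pmatrix}\in\mathbb{R}\begin{pmatrix} 1 \\ u' \end{pmatrix}$. For $n\ge 2$ the conformal transformations of $S^n$ are exactly the maps given by this action, and each is canonically identified with an element of $G$; for $n=1$ the conformal transformations of $S^1$ are by definition the maps given by this action of $O_o(1,2)$. Algebraic polar factorization (Cartan decomposition): $G=\exp(\mathfrak{p})\,SO(n+1)$, where $SO(n+1)$ is embedded in $G$ as the matrices $\mathrm{diag}(1,R)$ with $R\in SO(n+1)$, and $\mathfrak{p}=\left\{\begin{pmatrix} 0 & v^t \\ v & 0 \end{pmatrix}\;\middle|\; v\in\mathbb{R}^{n+1}\right\}$ is the space of symmetric matrices in the Lie algebra $o(1,n+1)$ of $G$; each element of $G$ is written uniquely as a product $PO$ with $P\in\exp(\mathfrak{p})$, $O\in SO(n+1)$. *)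

(* Defs.v *)
(* Points of R^m are column vectors 'cV[R]_m, and the sphere S^n lives in
   'cV[R]_n.+1.  The norm `|x| on matrices is the sup norm: it only serves for
   the topology, and lengths are computed with the Euclidean norm [enorm]. *)
From HB Require Import structures.
From mathcomp Require Import all_boot all_order all_algebra.
From mathcomp Require Import all_classical all_reals all_analysis.
From mathcomp Require Import measurable_realfun ring.
Import Order.TTheory GRing.Theory Num.Theory.
Import numFieldNormedType.Exports.

Set Implicit Arguments.
Unset Strict Implicit.
Unset Printing Implicit Defensive.

Local Open Scope classical_set_scope.
Local Open Scope ring_scope.

Definition dotp (R : realType) (m : nat) (x y : 'cV[R]_m) : R :=
  \sum_i x i 0 * y i 0.

Definition enorm (R : realType) (m : nat) (x : 'cV[R]_m) : R :=
  Num.sqrt (dotp x x).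

Definition unit_sphere (R : realType) (n : nat) : set 'cV[R]_n.+1 :=
  [set x | enorm x = 1].
Arguments unit_sphere : clear implicits.

(* The coercion from sets to types gives S^n its subspace topology. *)
Definition sphere (R : realType) (n : nat) : Type := unit_sphere R n.

Section sphere_instances.
Variables (R : realType) (n : nat).

Lemma delta_sphere : (delta_mx 0 0 : 'cV[R]_n.+1) \in unit_sphere R n.
Proof.
rewrite inE /unit_sphere /= /enorm /dotp big_ord_recl big1 => [|i _].
  by rewrite !mxE !eqxx mulr1 addr0 sqrtr1.
by rewrite !mxE mulr0.
Qed.

HB.instance Definition _ := Topological.on (sphere R n).

HB.instance Definition _ := Choice.on (sphere R n).

HB.instance Definition _ :=
  isPointed.Build (sphere R n) (exist _ (delta_mx 0 0) delta_sphere).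

Let borel : set (set (sphere R n)) := <<s @open (sphere R n) >>.

Let borel0 : borel set0. Proof. exact: sigma_algebra0. Qed.

Let borelC A : borel A -> borel (~` A).
Proof. by move=> ?; rewrite -setTD; exact: sigma_algebraCD. Qed.

Let borelU (F : (set (sphere R n))^nat) :
  (forall i, borel (F i)) -> borel (\bigcup_i F i).
Proof. exact: sigma_algebra_bigcup. Qed.

HB.instance Definition _ := @isMeasurable.Build
  (sigma_display (@open (sphere R n))) (sphere R n) borel borel0 borelC borelU.

End sphere_instances.

(* Lebesgue measure on R^n, carried by n-tuples, whose measurable sets are
   generated by the coordinates. *)
Section lebesgue_n.
Variable R : realType.

Definition tcons (n : nat) (x : R * n.-tuple R) : n.+1.-tuple R :=
  [tuple of x.1 :: x.2].

Lemma measurable_tcons n : measurable_fun setT (@tcons n).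
Proof. exact: (measurable_cons measurable_fst measurable_snd). Qed.

Section step.
Variables (n : nat) (mu : {sigma_finite_measure set (n.-tuple R) -> \bar R}).

Definition leb_step : set (n.+1.-tuple R) -> \bar R :=
  pushforward (@lebesgue_measure R \x mu)%E (@tcons n).

Let leb_step0 : leb_step set0 = 0%E.
Proof. by rewrite /leb_step /pushforward preimage_set0 measure0. Qed.

Let leb_step_ge0 A : (0 <= leb_step A)%E.
Proof. by rewrite /leb_step /pushforward measure_ge0. Qed.

Let leb_step_sigma_additive : semi_sigma_additive leb_step.
Proof.
move=> F mF tF mUF.
have m G : measurable G -> measurable (@tcons n @^-1` G).
  by move=> mG; rewrite -[X in measurable X]setTI; exact: measurable_tcons.
rewrite /leb_step /pushforward preimage_bigcup.
apply: measure_semi_sigma_additive => //.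
- by move=> k; exact: m.
- apply/trivIsetP => i j _ _ ij; rewrite -preimage_setI.
  by move/trivIsetP : tF => /(_ _ _ _ _ ij) ->//; rewrite preimage_set0.
- by rewrite -preimage_bigcup; exact: m.
Qed.

HB.instance Definition _ := isMeasure.Build _ _ _ leb_step
  leb_step0 leb_step_ge0 leb_step_sigma_additive.

Let leb_step_sigma_finite : sigma_finite setT leb_step.
Proof.
have /sigma_finiteP[F [FT ndF Foo]] := sigma_finiteT (@lebesgue_measure R).
have /sigma_finiteP[G [GT ndG Goo]] := sigma_finiteT mu.
pose u (t : n.+1.-tuple R) := (thead t, [tuple of behead t]).
have mu' : measurable_fun setT u.
  apply: measurable_fun_pair; first exact: measurable_tnth.
  exact: measurable_behead.
have Ku : u \o @tcons n = id.
  apply/funext => -[x t]; rewrite /tcons /u /= theadE; congr pair.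
  exact/val_inj.
exists (fun k => u @^-1` (F k `*` G k)).
  rewrite -preimage_bigcup (_ : \bigcup_i _ = setT) ?preimage_setT//.
  apply/seteqP; split => // -[x y] _.
  have [i _ Fx] : (\bigcup_i F i) x by rewrite -FT.
  have [j _ Gy] : (\bigcup_i G i) y by rewrite -GT.
  exists (maxn i j) => //; split => /=.
    by move: x Fx; exact/subsetPset/ndF/leq_maxl.
  by move: y Gy; exact/subsetPset/ndG/leq_maxr.
move=> k; have [mF Fk] := Foo k; have [mG Gk] := Goo k; split.
  by rewrite -[X in measurable X]setTI; apply: mu' => //; exact: measurableX.
rewrite /leb_step /pushforward -comp_preimage Ku preimage_id.
by rewrite product_measure1E// lte_mul_pinfty// ge0_fin_numE.
Qed.

HB.instance Definition _ := Measure_isSigmaFinite.Build _ _ _ leb_step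
  leb_step_sigma_finite.

End step.

Fixpoint lebesgue_n (n : nat) :
    {sigma_finite_measure set (n.-tuple R) -> \bar R} :=
  match n return {sigma_finite_measure set (n.-tuple R) -> \bar R} with
  | 0 => \d_[tuple]
  | m.+1 => leb_step (lebesgue_n m)
  end.

End lebesgue_n.

Definition col_of_tuple (R : realType) (n : nat) (t : n.-tuple R) : 'cV[R]_n :=
  \col_i tnth t i.

(* The Riemannian density sqrt (det g_ij) in a local parametrization phi of a
   submanifold of Euclidean space, where g_ij = <d_i phi, d_j phi>. *)
Section riemannian_density.
Variables (R : realType) (n m : nat) (phi : 'cV[R]_n -> 'cV[R]_m).

Definition jacobian_mx (y : 'cV[R]_n) : 'M[R]_(m, n) :=
  \matrix_(k, i) derive1 (fun t : R => phi (y + t *: delta_mx i 0) k 0) 0.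

Definition metric_mx (y : 'cV[R]_n) : 'M[R]_n :=
  (jacobian_mx y)^T *m jacobian_mx y.

Definition riemannian_density (y : 'cV[R]_n) : R :=
  Num.sqrt (\det (metric_mx y)).

End riemannian_density.

(* The column vector (1, y). *)
Definition homog (R : realType) (m : nat) (y : 'cV[R]_m) : 'cV[R]_(1 + m) :=
  col_mx (1%:M : 'M[R]_1) y.

Lemma dotp_ge0 (R : realType) m (x : 'cV[R]_m) : 0 <= dotp x x.
Proof. by apply: sumr_ge0 => i _; rewrite -expr2 sqr_ge0. Qed.

Lemma dotp_homog (R : realType) m (y : 'cV[R]_m) :
  dotp (homog y) (homog y) = 1 + dotp y y.
Proof.
rewrite /dotp big_split_ord /= big_ord1 !col_mxEu !mxE eqxx mulr1; congr +%R.
by apply: eq_bigr => i _; rewrite col_mxEd.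
Qed.

Section sphere_volume.
Variables (R : realType) (n : nat).

(* Central projection: a bijective parametrization of the open hemisphere of
   vectors with positive (e = true) or negative (e = false) first coordinate. *)
Definition gnomonic (e : bool) (y : 'cV[R]_n) : 'cV[R]_n.+1 :=
  ((-1) ^+ (~~ e) / enorm (homog y)) *: homog y.

Lemma gnomonic_sphere e y : gnomonic e y \in unit_sphere R n.
Proof.
rewrite inE /unit_sphere /= /enorm /gnomonic; set c := _ / _.
have w0 : 0 < dotp (homog y) (homog y).
  by rewrite dotp_homog ltr_pwDl// dotp_ge0.
have -> : dotp (c *: homog y) (c *: homog y) = c ^+ 2 * dotp (homog y) (homog y).
  by rewrite /dotp mulr_sumr; apply: eq_bigr => i _; rewrite !mxE mulrACA expr2.
rewrite /c expr_div_n sqrr_sign sqr_sqrtr ?ltW// mul1r mulVf ?sqrtr1//.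
by rewrite gt_eqF.
Qed.

Definition gnomonic_chart (e : bool) (y : 'cV[R]_n) : sphere R n :=
  exist _ (gnomonic e y) (gnomonic_sphere e y).

Let col_of_tuple_meas (i : 'I_n) :
  measurable_fun setT (fun t : n.-tuple R => col_of_tuple t i 0).
Proof.
rewrite (_ : (fun _ => _) = (fun t => tnth t i)); first exact: measurable_tnth.
by apply/funext => t; rewrite mxE.
Qed.

Let dotp_meas d (T : measurableType d) m (f : T -> 'cV[R]_m) :
  (forall i, measurable_fun setT (fun t => f t i 0)) ->
  measurable_fun setT (fun t => dotp (f t) (f t)).
Proof.
by move=> mf; apply: measurable_sum => i; apply: measurable_funM.
Qed.

Let homog_meas (k : 'I_(1 + n)) :
  measurable_fun setT (fun t : n.-tuple R => homog (col_of_tuple t) k 0).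
Proof.
rewrite /homog; case: (split_ordP k) => j ->.
  rewrite (_ : (fun _ => _) = cst ((1%:M : 'M[R]_1) j 0)).
    exact: measurable_cst.
  by apply/funext => t; rewrite col_mxEu.
rewrite (_ : (fun _ => _) = (fun t : n.-tuple R => col_of_tuple t j 0)).
  exact: col_of_tuple_meas.
by apply/funext => t; rewrite col_mxEd.
Qed.

Lemma enorm_homog_gt0 (y : 'cV[R]_n) : 0 < enorm (homog y).
Proof. by rewrite sqrtr_gt0 dotp_homog ltr_pwDl// dotp_ge0. Qed.

Let inv_enorm_meas : measurable_fun setT
  (fun t : n.-tuple R => (enorm (homog (col_of_tuple t)))^-1).
Proof.
apply: (measurable_comp (F := [set x : R | 0 < x])
    (f := (GRing.inv : R -> R))).
- by rewrite -set_itvoy; exact: measurable_itv.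
- by move=> _ [t _ <-]; exact: enorm_homog_gt0.
- apply: open_continuous_measurable_fun; first exact: open_gt.
  by move=> x; rewrite inE /= => x0; apply: inv_continuous; rewrite gt_eqF.
- apply: (measurableT_comp (f := (Num.sqrt : R -> R))).
    by apply: continuous_measurable_fun; exact: sqrt_continuous.
  exact: dotp_meas.
Qed.

Lemma measurable_gnomonic e (k : 'I_n.+1) :
  measurable_fun setT (fun t : n.-tuple R => gnomonic e (col_of_tuple t) k 0).
Proof.
under eq_fun do rewrite mxE.
by apply: measurable_funM => //; exact: measurable_funM.
Qed.

Lemma measurable_open_preimage d (T : measurableType d) m (f : T -> 'cV[R]_m)
    (W : set 'cV[R]_m) :
  (forall i, measurable_fun setT (fun t => f t i 0)) -> open W ->
  measurable (f @^-1` W).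
Proof.
move=> mf oW.
pose rv (q : 'cV[rat]_m) : 'cV[R]_m := map_mx ratr q.
pose box (z : 'cV[rat]_m * nat) := ball (rv z.1) (z.2.+1%:R^-1 : R).
have boxE z x : box z x <-> forall i, `|rv z.1 i 0 - x i 0| < z.2.+1%:R^-1.
  split=> [[_ b] i|b]; first exact: (b i 0).
  split; first by rewrite invr_gt0.
  by move=> i j; rewrite (ord1 j); exact: b.
have mbox z : measurable (f @^-1` box z).
  rewrite (_ : _ @^-1` _ = \bigcap_(i in [set: 'I_m])
      (fun t => f t i 0) @^-1` ball (rv z.1 i 0) z.2.+1%:R^-1); last first.
    apply/seteqP; split => t.
      by move=> /boxE b i _; exact: b.
    by move=> b; apply/boxE => i; exact: b.
  apply: fin_bigcap_measurable => // i _.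
  rewrite -[X in measurable X]setTI; apply: mf => //.
  exact: open_measurable (ball_open _ _).
rewrite (_ : f @^-1` W = \bigcup_(z in [set z | box z `<=` W]) f @^-1` box z).
  rewrite bigcup_mkcond; apply: countable_bigcupT_measurable => // z.
  by case: ifPn.
apply/seteqP; split => [t Wt|t [z zW]]; last exact: zW.
have /nbhs_ballP[r /= r0 rW] : nbhs (f t) W by exact: open_nbhs_nbhs.
have [k kr] : exists k : nat, k.+1%:R^-1 < r / 2.
  have r20 : 0 < r / 2 by rewrite divr_gt0.
  have [k _ /(_ _ (leqnn k)) kr] := near_infty_natSinv_lt (PosNum r20).
  by exists k.
have /choice[q qE] : forall i, exists q : rat, `|ratr q - f t i 0| < k.+1%:R^-1.
  move=> i; set e := k.+1%:R^-1.
  have e0 : 0 < e by rewrite invr_gt0.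
  have [q] : exists q : rat, ratr q \in `]f t i 0, f t i 0 + e[%R.
    by apply: rat_in_itvoo; rewrite ltrDl.
  rewrite in_itv /= => /andP[q1 q2]; exists q.
  by rewrite ger0_norm ?subr_ge0 ?(ltW q1)// ltrBlDl.
exists (\col_i q i, k); last by apply/boxE => i; rewrite !mxE.
move=> x /boxE xb; apply: rW; split=> // i j; rewrite (ord1 j).
have := xb i; rewrite !mxE /= => xi; have ti := qE i.
rewrite /ball /= (splitr r) -(subrKA (ratr (q i))) addrC.
by rewrite (le_lt_trans (ler_normD _ _))// ltrD// ?(distrC (f t i 0)) (lt_trans _ kr).
Qed.

Lemma measurable_gnomonic_chart e :
  measurable_fun setT (fun t : n.-tuple R => gnomonic_chart e (col_of_tuple t)).
Proof.
apply: (@measurability _ _ _ _ _ _ (@open (sphere R n))) => //.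
move=> _ [_ [W oW <-] <-]; rewrite setTI.
exact: (measurable_open_preimage (measurable_gnomonic e) oW).
Qed.

Lemma jacobian_gnomonic e (y : 'cV[R]_n) (k : 'I_(1 + n)) (i : 'I_n) :
  jacobian_mx (gnomonic e) y k i =
  (-1) ^+ (~~ e) * ((k == rshift 1 i)%:R / enorm (homog y) -
    homog y k 0 * y i 0 / enorm (homog y) ^+ 3).
Proof.
set a := (-1) ^+ _; set del := (_ == _)%:R; set h := homog y k 0.
set q := dotp (homog y) (homog y); pose p := y i 0.
have q0 : 0 < q by rewrite /q dotp_homog ltr_pwDl// dotp_ge0.
have hE t : homog (y + t *: delta_mx i 0) k 0 = h + t * del.
  rewrite /h /del /homog; case: (split_ordP k) => j ->.
    by rewrite !col_mxEu eq_lrshift mulr0 addr0.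
  by rewrite !col_mxEd !mxE eqxx andbT eq_rshift.
have qE t : dotp (homog (y + t *: delta_mx i 0))
    (homog (y + t *: delta_mx i 0)) = q + (t * (2 * p) + t * t).
  rewrite /q !dotp_homog -addrA; congr +%R.
  rewrite /dotp (bigD1 i)//= [in RHS](bigD1 i)//=.
  under eq_bigr => j ji do rewrite !mxE (negbTE ji) mulr0 addr0.
  by rewrite !mxE !eqxx /p /= mulr1; ring.
rewrite mxE (_ : (fun _ => _) = fun t : R =>
    a * ((Num.sqrt (q + (t * (2 * p) + t * t)))^-1 * (h + t * del))); last first.
  by apply/funext => t; rewrite mxE hE /enorm qE; exact: esym (mulrA _ _ _).
have did : is_derive (0 : R) (1 : R) (id : R -> R) 1 by exact: is_derive_id.
have dl (c : R) : is_derive (0 : R) (1 : R) (fun t : R => t * c) c.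
  apply: is_derive_eq (is_deriveM did (is_derive_cst c _ _)) _.
  by rewrite /GRing.scale /=; ring.
have dq : is_derive (0 : R) (1 : R)
    (fun t : R => q + (t * (2 * p) + t * t)) (2 * p).
  apply: is_derive_eq (is_deriveD (is_derive_cst q _ _)
    (is_deriveD (dl _) (is_deriveM did did))) _.
  by rewrite /GRing.scale /=; ring.
have dn : is_derive (0 : R) (1 : R) (fun t : R => h + t * del) del.
  apply: is_derive_eq (is_deriveD (is_derive_cst h _ _) (dl del)) _.
  by rewrite add0r.
have e0 : q + (0 * (2 * p) + 0 * 0) = q by ring.
have ds : is_derive (0 : R) (1 : R)
    (fun t : R => Num.sqrt (q + (t * (2 * p) + t * t)))
    ((2 * Num.sqrt q)^-1 * (2 * p)).
  apply: (is_derive1_comp (f := Num.sqrt)) dq.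
  by rewrite e0; exact: is_derive1_sqrt.
have s0 : Num.sqrt q != 0 by rewrite gt_eqF// sqrtr_gt0.
pose sq (t : R) := Num.sqrt (q + (t * (2 * p) + t * t)).
have sq0 : sq 0 != 0 by rewrite /sq e0.
have dv := is_deriveM (is_derive_cst a _ _)
  (is_deriveM (is_deriveV (f := sq) sq0 ds) dn).
rewrite derive1E; apply: etrans (derive_val (is_derive := dv)) _.
rewrite /GRing.scale /= mulr0 addr0 mul0r addr0 /sq e0 /enorm -/q -/p.
by field.
Qed.

Lemma measurable_gnomonic_density e : measurable_fun setT
  (fun t : n.-tuple R => riemannian_density (gnomonic e) (col_of_tuple t)).
Proof.
have mJ k i : measurable_fun setT (fun t : n.-tuple R =>
    jacobian_mx (gnomonic e) (col_of_tuple t) k i).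
  under eq_fun do rewrite jacobian_gnomonic.
  apply: measurable_funM => //; apply: measurable_funB.
    exact: measurable_funM.
  apply: measurable_funM; first exact: measurable_funM.
  under eq_fun do rewrite -exprVn.
  exact: measurable_funX.
apply: (measurableT_comp (f := (Num.sqrt : R -> R))).
  by apply: continuous_measurable_fun; exact: sqrt_continuous.
apply: measurable_sum => s; apply: measurable_funM => //.
apply: measurable_prod => i _.
under eq_fun do rewrite mxE.
apply: measurable_sum => k; under eq_fun do rewrite mxE.
exact: measurable_funM.
Qed.

(* The Riemannian measure of S^n, computed in the charts [gnomonic_chart]: the
   great sphere that they miss is a submanifold of lower dimension, hence has
   measure zero. *)
Definition sphere_vol (B : set (sphere R n)) : \bar R :=
  (\sum_(e : bool)
    \int[lebesgue_n R n]_(t in [set t | B (gnomonic_chart e (col_of_tuple t))])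
      (riemannian_density (gnomonic e) (col_of_tuple t))%:E)%E.


Let vol0 : sphere_vol set0 = 0%E.
Proof. by rewrite /sphere_vol big1// => e _; rewrite integral_set0. Qed.

Let vol_ge0 B : (0 <= sphere_vol B)%E.
Proof.
apply: sume_ge0 => e _; apply: integral_ge0 => t _.
by rewrite lee_fin sqrtr_ge0.
Qed.

Let vol_sigma_additive : semi_sigma_additive sphere_vol.
Proof.
move=> F mF tF mUF.
pose c e (t : n.-tuple R) := gnomonic_chart e (col_of_tuple t).
pose I e B := (\int[lebesgue_n R n]_(t in c e @^-1` B)
  (riemannian_density (gnomonic e) (col_of_tuple t))%:E)%E.
have I_ge0 e B : (0 <= I e B)%E.
  by apply: integral_ge0 => t _; rewrite lee_fin sqrtr_ge0.
have volE B : sphere_vol B = (I true B + I false B)%E.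
  by rewrite /sphere_vol big_bool.
have IU e : I e (\bigcup_k F k) = (\sum_(k <oo) I e (F k))%E.
  rewrite /I preimage_bigcup ge0_integral_bigcup//.
  - move=> k; rewrite -[X in measurable X]setTI.
    exact: measurable_gnomonic_chart.
  - apply: measurable_funTS; apply/measurable_EFinP.
    exact: measurable_gnomonic_density.
  - by move=> t _; rewrite lee_fin sqrtr_ge0.
  - apply/trivIsetP => i j _ _ ij; rewrite -preimage_setI.
    by move/trivIsetP : tF => /(_ _ _ _ _ ij) ->//; rewrite preimage_set0.
rewrite [X in _ --> X](_ : _ = (\sum_(k <oo) sphere_vol (F k))%E).
  by apply: is_cvg_ereal_nneg_natsum_cond => k _ _; exact: vol_ge0.
rewrite volE !IU -nneseriesD//.
by apply: eq_eseriesr => k _; rewrite volE.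
Qed.

HB.instance Definition _ := isMeasure.Build _ _ _ sphere_vol
  vol0 vol_ge0 vol_sigma_additive.

End sphere_volume.

Arguments sphere_vol {R n}.

Section transport.
Variables (R : realType) (n : nat).
Implicit Types (p q : sphere R n) (F T U S : sphere R n -> sphere R n).

(* C^1 curves joining p to q in S^n; only the restriction to [0, 1] matters,
   and a C^1 curve on [0, 1] always extends to a C^1 curve on the line. *)
Definition sphere_curve p q : set (R -> 'cV[R]_n.+1) :=
  [set g : R -> 'cV[R]_n.+1 |
    [/\ forall t : R, derivable g t (1 : R), continuous (derive1 g),
        g 0 = \val p, g 1 = \val q &
        forall t, 0 <= t <= 1 -> unit_sphere R n (g t)]].

Definition curve_length (g : R -> 'cV[R]_n.+1) : R :=
  \int[lebesgue_measure]_(t in `[0, 1]) enorm (derive1 g t).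

Definition geodesic_dist p q : R :=
  inf [set curve_length g | g in sphere_curve p q].

Definition cost p q : R := geodesic_dist p q ^+ 2 / 2.

Definition pushes_to (mu nu : set (sphere R n) -> \bar R) F : Prop :=
  measurable_fun setT F /\
  forall B, measurable B -> pushforward mu F B = nu B.

Definition optimal_map (mu : {measure set (sphere R n) -> \bar R})
    (nu : set (sphere R n) -> \bar R) T : Prop :=
  pushes_to mu nu T /\
  forall T', pushes_to mu nu T' ->
    (\int[mu]_x (cost x (T x))%:E <= \int[mu]_x (cost x (T' x))%:E)%E.

Definition volume_preserving U : Prop := pushes_to sphere_vol sphere_vol U.

(* The Brenier-McCann polar factorization: S = T o U is only asked a.e. *)
Definition polar_factorization S T U : Prop :=
  [/\ optimal_map sphere_vol (pushforward sphere_vol S) T,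
      volume_preserving U &
      {ae sphere_vol, forall x, S x = T (U x)}].

End transport.

Section lorentz.
Variables (R : realType) (n : nat).

Definition lorentz_form : 'M[R]_(1 + n.+1) := block_mx 1%:M 0 0 (- 1%:M).

Definition lorentz_group : set 'M[R]_(1 + n.+1) :=
  [set A | A^T *m lorentz_form *m A = lorentz_form].

(* O_o(1, n+1) *)
Definition lorentz_group0 : set 'M[R]_(1 + n.+1) :=
  connected_component lorentz_group 1%:M.

(* The action on S^n; if no such u' exists, which does not happen for A in the
   group, the value is u. *)
Definition act (A : 'M[R]_(1 + n.+1)) (u : sphere R n) : sphere R n :=
  xget u [set u' | exists k : R, A *m homog (\val u) = k *: homog (\val u')].

Definition so_group : set 'M[R]_n.+1 :=
  [set O | O^T *m O = 1%:M /\ \det O = 1].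

Definition so_embed (O : 'M[R]_n.+1) : 'M[R]_(1 + n.+1) :=
  block_mx 1%:M 0 0 O.

Definition expm m (X : 'M[R]_m) : 'M[R]_m :=
  limn (series (fun k => k`!%:R^-1 *: X ^+ k)).

(* The symmetric matrices in the Lie algebra o(1, n+1). *)
Definition boosts : set 'M[R]_(1 + n.+1) :=
  [set X | exists v : 'cV[R]_n.+1, X = block_mx 0 v^T v 0].

Definition exp_boosts : set 'M[R]_(1 + n.+1) := [set expm X | X in boosts].

End lorentz.

Arguments lorentz_group : clear implicits.
Arguments lorentz_group0 : clear implicits.
Arguments so_group : clear implicits.
Arguments boosts : clear implicits.
Arguments exp_boosts : clear implicits.

(* Main.v *)
(* P acts on S^n by pushing every point along its meridian towards an axis e:
   the angle theta to e becomes tau(theta), with tau increasing on [0, pi].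
   If F is an antiderivative of tau, then phi = theta^2/2 - F(theta) and its
   transform psi satisfy phi(x) + psi(y) <= (theta_x - theta_y)^2/2, with
   equality iff theta_y = tau(theta_x), by strict convexity of F.  Since
   d(x, y) >= |theta_x - theta_y|, with equality for x, y on a common meridian,
   phi and psi are Kantorovich potentials touching the cost exactly along the
   graph of P: P is the unique optimal map.
   That O preserves the volume follows from vol(B) = (n+1) Leb(cone over B) and
   the orthogonal invariance of Lebesgue measure.  Finally U is determined by
   T o U = S because P acts injectively. *)
Require Import Defs.
From HB Require Import structures.
From mathcomp Require Import all_boot all_order all_algebra.
From mathcomp Require Import all_classical all_reals all_analysis.
From mathcomp Require Import measurable_realfun ring lra.
Import Order.TTheory GRing.Theory Num.Theory.
Import numFieldNormedType.Exports.

Local Open Scope classical_set_scope.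
Local Open Scope ring_scope.

Set Implicit Arguments.
Unset Strict Implicit.
Unset Printing Implicit Defensive.

(** * Affine changes of variables for Lebesgue measure *)

(** The map tau is explicit: the cosine of the angle to [e] undergoes the homography [mobius C S],
    with [C], [S] a hyperbolic cosine and sine, whose inverse is [mobius C (- S)]. All its
    properties on [[0, pi]], poles included, come from this formula. The distance is an infimum of
    lengths of C^1 curves, so it must first be identified with [acos] of the inner product. The hard
    inequality is that no curve is shorter, and the obstacle is the singularity of [acos] at -1 and
    1. The volume is computed in two charts attached to the first coordinate, which a rotation does
    not respect; hence the detour through cones. It works because the gnomonic density [w^-(n+1)] is
    [n + 1] times the integral of [x^n] over []0, 1/w]]. For uniqueness, strict convexity of F only
    forces the angle of y; on the parallel of P x, strictness comes from the equality case of the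
    bound on d. *)

Lemma measurable_affine (R : realType) (a b : R) :
  measurable_fun setT (fun x : R => a * x + b).
Proof. by apply: measurable_funD => //; apply: measurable_funM. Qed.

Section lebesgue_affine.
Context {R : realType}.
Variables (a b : R).
Hypothesis a0 : a != 0.

Let aff (x : R) : R := a * x + b.

Let maff : measurable_fun setT aff.
Proof. exact: measurable_affine. Qed.

Let na : {nonneg R} := NngNum (normr_ge0 a).

(** Uniqueness of Lebesgue measure: the push-forward by the affine map, rescaled by [|a|], gives
    each []u, v]] its length. For [a < 0] the preimage is closed at the other end, hence the two
    cases. *)
Lemma lebesgue_measure_affine (B : set R) : measurable B ->
  lebesgue_measure ((fun x => a * x + b) @^-1` B) =
  (`|a|^-1%:E * lebesgue_measure B)%E.
Proof.
move=> mB.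
pose mu : {measure set (measurableTypeR R) -> \bar R} :=
  measure_function_pushforward__canonical__measure_function_Measure
    (T2 := measurableTypeR R) (@lebesgue_measure R) maff.
pose nu : {measure set (measurableTypeR R) -> \bar R} := mscale na mu.
have na0 : `|a| != 0 by rewrite normr_eq0.
have nuE C : nu C = (`|a|%:E * lebesgue_measure (aff @^-1` C))%E by [].
suff -> : lebesgue_measure B = nu B.
  by rewrite nuE muleA -EFinM mulVf// mul1e.
apply: (lebesgue_measure_unique (mu := nu)) => // X [[u v] /= _ <-].
rewrite nuE.
have [agt0|alt0|/eqP] := ltrgtP a 0; last by rewrite (negbTE a0).
- have -> : aff @^-1` `]u, v]%classic = `[(v - b) / a, (u - b) / a[%classic.
    apply/seteqP; split => x /=; rewrite !in_itv/= ?ler_ndivrMr ?ltr_ndivlMr ?/aff//;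
    by rewrite lerBrDr ltrBlDr (mulrC x) andbC.
  rewrite !lebesgue_measure_itv /= !lte_fin ltr_ndivlMr // divfK // ltrD2r.
  rewrite ltr0_norm//; case: ifPn => // _; last by rewrite mule0.
  by rewrite -!EFinB -EFinM; congr EFin; field.
- have -> : aff @^-1` `]u, v]%classic = `](u - b) / a, (v - b) / a]%classic.
    apply/seteqP; split => x /=; rewrite !in_itv/= ?ltr_pdivrMr ?ler_pdivlMr ?/aff//;
    by rewrite lerBrDr ltrBlDr (mulrC x).
  rewrite !lebesgue_measure_itv /= !lte_fin ltr_pdivrMr // divfK // ltrD2r.
  rewrite gtr0_norm//; case: ifPn => // _; last by rewrite mule0.
  by rewrite -!EFinB -EFinM; congr EFin; field.
Qed.

Lemma ge0_integral_affine (f : R -> \bar R) : measurable_fun setT f ->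
  (forall x, (0 <= f x)%E) ->
  (\int[lebesgue_measure]_x f (a * x + b)%R =
   `|a|^-1%:E * \int[lebesgue_measure]_x f x)%E.
Proof.
move=> mf f0.
have ni0 : 0 <= `|a|^-1 by rewrite invr_ge0.
pose k : {nonneg R} := NngNum ni0.
have := @ge0_integral_pushforward _ _ (measurableTypeR R) (measurableTypeR R)
  R aff maff (@lebesgue_measure R) setT f measurableT mf (fun x _ => f0 x).
rewrite preimage_setT => <-.
rewrite -[RHS](@ge0_integral_mscale _ _ _ (@lebesgue_measure R) _ measurableT k f mf)//.
apply: (eq_measure_integral (mscale k (@lebesgue_measure R))) => A mA _.
exact: lebesgue_measure_affine mA.
Qed.

End lebesgue_affine.

Section lebesgue_n_affine.
Context {R : realType}.

Lemma lebesgue_nS n (B : set (n.+1.-tuple R)) :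
  lebesgue_n R n.+1 B =
  (\int[lebesgue_measure]_x lebesgue_n R n [set t | B (tcons (x, t))])%E.
Proof.
rewrite /= /leb_step /pushforward /product_measure1; apply: eq_integral => x _ /=.
by congr (lebesgue_n R n _); apply/seteqP; split => t; rewrite /xsection/= inE.
Qed.

Lemma measurable_lebesgue_n_section n (B : set (n.+1.-tuple R)) :
  measurable B ->
  measurable_fun setT (fun x : R => lebesgue_n R n [set t | B (tcons (x, t))]).
Proof.
move=> mB.
have mB' : measurable (@tcons R n @^-1` B).
  by rewrite -[X in measurable X]setTI; exact: measurable_tcons.
rewrite (_ : (fun _ => _) = lebesgue_n R n \o xsection (@tcons R n @^-1` B)).
  exact: measurable_fun_xsection.
apply/funext => x /=.
by congr (lebesgue_n R n _); apply/seteqP; split => t; rewrite /xsection/= inE.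
Qed.

(** One ratio [a] for all coordinates covers the three uses: translations ([a = 1]), the central
    symmetry ([a = -1]) and the homotheties between a chart and a slice of a cone. *)
Definition taff (n : nat) (a : R) (b t : n.-tuple R) : n.-tuple R :=
  [tuple a * tnth t i + tnth b i | i < n].

Lemma taff_tcons n a (b : n.+1.-tuple R) x (t : n.-tuple R) :
  taff a b (tcons (x, t)) =
  tcons (a * x + thead b, taff a [tuple of behead b] t).
Proof.
apply: eq_from_tnth => i; rewrite tnth_mktuple.
have [j ->|->] := unliftP ord0 i; last by rewrite [b in LHS]tuple_eta !tnth0.
by rewrite [b in LHS]tuple_eta !tnthS tnth_mktuple.
Qed.

(** Induction on the dimension: the slices along the first coordinate contribute all factors
    [|a|^-1] but one, and the outer one-dimensional integral the last. *)
Lemma lebesgue_n_taff n a (b : n.-tuple R) (B : set (n.-tuple R)) : a != 0 ->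
  measurable B ->
  lebesgue_n R n (taff a b @^-1` B) = ((`|a|^-1 ^+ n)%:E * lebesgue_n R n B)%E.
Proof.
move=> a0; elim: n b B => [|n IH] b B mB.
  rewrite expr0 mul1e (_ : taff a b = id)//; apply/funext => t.
  by rewrite [LHS]tuple0 [RHS]tuple0.
rewrite !lebesgue_nS.
have mS (x : R) : measurable [set t : n.-tuple R | B (tcons (x, t))].
  rewrite -[X in measurable X]setTI; apply: (_ : measurable_fun setT (fun t => tcons (x, t))) => //.
  apply: measurableT_comp; first exact: measurable_tcons.
  exact: measurable_pair1.
under eq_integral => x _.
  rewrite (_ : [set t | _] = taff a [tuple of behead b] @^-1`
      [set t | B (tcons (a * x + thead b, t))]); last first.
    by apply/seteqP; split => t /=; rewrite taff_tcons.
  rewrite IH//; over.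
have mF := measurable_lebesgue_n_section mB.
rewrite ge0_integralZl_EFin//=; last first.
  exact: (measurableT_comp mF (measurable_affine a (thead b))).
rewrite (ge0_integral_affine (thead b) a0 mF)//.
by rewrite muleA -EFinM exprSr.
Qed.

End lebesgue_n_affine.

(** * Orthogonal invariance of Lebesgue measure *)

Section dotp_theory.
Context {R : realType}.
Implicit Types m : nat.

Lemma dotpE m (x y : 'cV[R]_m) : dotp x y = (x^T *m y) 0 0.
Proof. by rewrite mxE; apply: eq_bigr => i _; rewrite mxE. Qed.

Lemma dotpC m (x y : 'cV[R]_m) : dotp x y = dotp y x.
Proof. by apply: eq_bigr => i _; rewrite mulrC. Qed.

Lemma dotpDr m (x y z : 'cV[R]_m) : dotp x (y + z) = dotp x y + dotp x z.
Proof. by rewrite /dotp -big_split; apply: eq_bigr => i _; rewrite mxE mulrDr. Qed.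

Lemma dotpZr m a (x y : 'cV[R]_m) : dotp x (a *: y) = a * dotp x y.
Proof. by rewrite /dotp mulr_sumr; apply: eq_bigr => i _; rewrite mxE mulrCA. Qed.

Lemma dotpDl m (x y z : 'cV[R]_m) : dotp (x + y) z = dotp x z + dotp y z.
Proof. by rewrite !(dotpC _ z) dotpDr. Qed.

Lemma dotpZl m a (x y : 'cV[R]_m) : dotp (a *: x) y = a * dotp x y.
Proof. by rewrite !(dotpC _ y) dotpZr. Qed.

Lemma dotpNr m (x y : 'cV[R]_m) : dotp x (- y) = - dotp x y.
Proof. by rewrite -scaleN1r dotpZr mulN1r. Qed.

Lemma dotpNl m (x y : 'cV[R]_m) : dotp (- x) y = - dotp x y.
Proof. by rewrite !(dotpC _ y) dotpNr. Qed.

Lemma dotp0r m (x : 'cV[R]_m) : dotp x 0 = 0.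
Proof. by rewrite -(scale0r (0 : 'cV[R]_m)) dotpZr mul0r. Qed.

Lemma dotp_eq0 m (x : 'cV[R]_m) : (dotp x x == 0) = (x == 0).
Proof.
apply/idP/eqP => [|->]; last by rewrite dotp0r.
rewrite psumr_eq0 => [/allP x0|i _]; last by rewrite -expr2 sqr_ge0.
apply/matrixP => i j; rewrite (ord1 j) mxE.
by have := x0 i (mem_index_enum _); rewrite /= -expr2 sqrf_eq0 => /eqP.
Qed.

Lemma dotp_mulmx m (O : 'M[R]_m) (x y : 'cV[R]_m) :
  O^T *m O = 1%:M -> dotp (O *m x) (O *m y) = dotp x y.
Proof. by move=> OO; rewrite !dotpE trmx_mul mulmxA -(mulmxA x^T) OO mulmx1. Qed.

End dotp_theory.

Definition tuple_of_col (R : realType) (n : nat) (x : 'cV[R]_n) : n.-tuple R :=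
  [tuple x i 0 | i < n].

Section tuple_col.
Context {R : realType}.

Lemma tuple_of_colK n : cancel (@tuple_of_col R n) (@col_of_tuple R n).
Proof. by move=> x; apply/matrixP => i j; rewrite mxE tnth_mktuple (ord1 j). Qed.

Lemma col_of_tupleK n : cancel (@col_of_tuple R n) (@tuple_of_col R n).
Proof. by move=> t; apply: eq_from_tnth => i; rewrite tnth_mktuple mxE. Qed.

Lemma measurable_col_of_tuple n (i : 'I_n) :
  measurable_fun setT (fun t : n.-tuple R => col_of_tuple t i 0).
Proof. by under eq_fun do rewrite mxE; exact: measurable_tnth. Qed.

Lemma measurable_dotp d (T : measurableType d) m (f g : T -> 'cV[R]_m) :
  (forall i, measurable_fun setT (fun t => f t i 0)) ->
  (forall i, measurable_fun setT (fun t => g t i 0)) ->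
  measurable_fun setT (fun t => dotp (f t) (g t)).
Proof.
by move=> mf mg; apply: measurable_sum => i; apply: measurable_funM.
Qed.

Lemma measurable_mulmx d (T : measurableType d) m k (A : 'M[R]_(k, m))
    (f : T -> 'cV[R]_m) :
  (forall i, measurable_fun setT (fun t => f t i 0)) ->
  forall i, measurable_fun setT (fun t => (A *m f t) i 0).
Proof.
move=> mf i; under eq_fun do rewrite mxE.
by apply: measurable_sum => j; apply: measurable_funM.
Qed.

Lemma measurable_tuple_of_col d (T : measurableType d) m (f : T -> 'cV[R]_m) :
  (forall i, measurable_fun setT (fun t => f t i 0)) ->
  measurable_fun setT (fun t => tuple_of_col (f t)).
Proof.
move=> mf; apply/measurable_fun_tnthP => i; rewrite /comp.
under eq_fun do rewrite tnth_mktuple.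
exact: mf.
Qed.

Lemma measurable_fun_pre d (T : measurableType d) d' (U : measurableType d')
  (f : T -> U) B : measurable_fun setT f -> measurable B -> measurable (f @^-1` B).
Proof. by move=> mf mB; rewrite -[X in measurable X]setTI; exact: mf. Qed.

End tuple_col.

(** It serves twice: as the rotation-invariant test set of the Haar argument, and as the truncation
    of cones. *)
Definition unit_ball (R : realType) (n : nat) : set (n.-tuple R) :=
  [set t | dotp (col_of_tuple t) (col_of_tuple t) <= 1].
Arguments unit_ball {R} n.

Definition cube (R : realType) (n : nat) (r : R) : set (n.-tuple R) :=
  [set t | forall i, `|tnth t i| <= r].
Arguments cube {R} n r.

Section unit_ball.
Context {R : realType}.

Lemma lebesgue_n_cube n (r : R) : 0 <= r ->
  lebesgue_n R n (cube n r) = ((2 * r) ^+ n)%:E.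
Proof.
move=> r0; elim: n => [|n IH].
  rewrite expr0 /= diracE mem_set//; by case.
rewrite lebesgue_nS.
transitivity (\int[lebesgue_measure]_(x in [set` `[- r, r]%R]) ((2 * r) ^+ n)%:E)%E.
  rewrite [RHS]integral_mkcond; apply: eq_integral => x _.
  rewrite patchE; case: ifPn => [|/negP]; rewrite inE /= in_itv /= -ler_norml => xr.
    rewrite -IH; congr (lebesgue_n R n _); apply/seteqP; split => t /= h i.
      by have := h (lift ord0 i); rewrite tnthS.
    have [j ->|->] := unliftP ord0 i; first by rewrite tnthS.
    by rewrite tnth0.
  rewrite (_ : [set t | _] = set0) ?measure0//.
  by rewrite -subset0 => t /(_ ord0) /=; rewrite tnth0.
rewrite integral_cst//= lebesgue_measure_itv/= lte_fin.
case: ifPn => [_|]; first by rewrite -EFinB -EFinM exprSr; congr (_ * _)%:E; ring.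
rewrite -leNgt => rN; have -> : r = 0 by apply: le_anti; rewrite r0 andbT; lra.
by rewrite mulr0 expr0n mule0 exprSr mulr0.
Qed.

Lemma measurable_unit_ball n : measurable (@unit_ball R n).
Proof.
rewrite (_ : @unit_ball R n = (fun t => dotp (col_of_tuple t) (col_of_tuple t))
    @^-1` [set` `]-oo, 1]]); last by apply/seteqP; split => t /=; rewrite in_itv.
apply: measurable_fun_pre => //.
by apply: measurable_dotp => i; exact: measurable_col_of_tuple.
Qed.

Lemma measurable_cube n (r : R) : measurable (cube n r).
Proof.
rewrite (_ : cube n r = \bigcap_(i in [set: 'I_n])
    (@tnth n R ^~ i @^-1` [set` `[- r, r]])); last first.
  apply/seteqP; split => t /=; first by move=> h i _ /=; rewrite in_itv /= -ler_norml.
  by move=> h i; have := h i I; rewrite /= in_itv /= -ler_norml.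
apply: fin_bigcap_measurable => // i _.
by apply: measurable_fun_pre => //; exact: measurable_tnth.
Qed.

Lemma lebesgue_n_unit_ball_fin n : (lebesgue_n R n (@unit_ball R n) < +oo)%E.
Proof.
apply: (@le_lt_trans _ _ (lebesgue_n R n (cube n 1))); last first.
  by rewrite lebesgue_n_cube// ltry.
apply: le_measure; rewrite ?inE; [exact: measurable_unit_ball|exact: measurable_cube|].
move=> t /= t1 i; rewrite -(@ler_pXn2r _ 2)// ?nnegrE// expr1n real_normK ?num_real//.
apply: le_trans t1; rewrite /dotp (bigD1 i)//= mxE -expr2 lerDl.
by apply: sumr_ge0 => j _; rewrite -expr2 sqr_ge0.
Qed.

(** The ball contains the cube of half-side [1/(n+1)]: [n] squares, each at most [1/(n+1)], have a
    sum at most 1. The shift by one covers [n = 0]. *)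
Lemma lebesgue_n_unit_ball_gt0 n : (0 < lebesgue_n R n (unit_ball n))%E.
Proof.
have r0 : 0 < n.+1%:R^-1 :> R by rewrite invr_gt0.
apply: (@lt_le_trans _ _ (lebesgue_n R n (cube n n.+1%:R^-1))).
  by rewrite lebesgue_n_cube ?(ltW r0)// lte_fin exprn_gt0// mulr_gt0.
apply: le_measure; rewrite ?inE; [exact: measurable_cube|exact: measurable_unit_ball|].
move=> t /= tr; rewrite /unit_ball /= /dotp.
apply: (@le_trans _ _ (\sum_(i < n) n.+1%:R^-1)).
  apply: ler_sum => i _; rewrite mxE -expr2 -real_normK ?num_real//.
  apply: (@le_trans _ _ (n.+1%:R^-1 ^+ 2)).
    by rewrite ler_pXn2r// nnegrE// ltW.
  by rewrite expr2 ler_piMr// ?(ltW r0)// invf_le1// ler1n.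
rewrite sumr_const card_ord -[leLHS]mulr_natl -[leRHS](@mulfV _ n.+1%:R)// ler_pM2r// ler_nat.
exact: leqnSn.
Qed.

End unit_ball.

Lemma sigma_finite_swap d1 d2 (T1 : measurableType d1) (T2 : measurableType d2)
    (R : realType) (m1 : {sigma_finite_measure set T1 -> \bar R})
    (m2 : {sigma_finite_measure set T2 -> \bar R}) (E : set (T1 * T2)) :
  measurable E ->
  (\int[m1]_x m2 [set y | E (x, y)] = \int[m2]_y m1 [set x | E (x, y)])%E.
Proof.
move=> mE; have := indic_fubini_tonelli m1 m2 mE.
rewrite (indic_fubini_tonelli_FE m2 mE) (indic_fubini_tonelli_GE m1 mE).
have -> : m2 \o xsection E = fun x => m2 [set y | E (x, y)].
  apply/funext => x /=; congr (m2 _).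
  by apply/seteqP; split => y; rewrite /xsection/= inE.
have -> // : m1 \o ysection E = fun y => m1 [set x | E (x, y)].
apply/funext => y /=; congr (m1 _).
by apply/seteqP; split => x; rewrite /ysection/= inE.
Qed.

(** Meant for fibres [F x] that are translates of a single set, so that they share the measure
    [c]. *)
Lemma integral_measure_if d1 d2 (T1 : measurableType d1) (T2 : measurableType d2)
    (R : realType) (m1 : {sigma_finite_measure set T1 -> \bar R})
    (m2 : {sigma_finite_measure set T2 -> \bar R}) (A : set T1) (F : T1 -> set T2) (c : \bar R) :
  measurable A -> (0 <= c)%E -> (forall x, m2 (F x) = c) ->
  (\int[m1]_x m2 [set y | A x /\ F x y] = c * m1 A)%E.
Proof.
move=> mA c0 mF; rewrite -integral_cst// [RHS]integral_mkcond.
apply: eq_integral => x _; rewrite patchE; case: ifPn => [|/negP]; rewrite inE => Ax.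
  by rewrite -(mF x); congr (m2 _); apply/seteqP; split => y //= -[].
rewrite (_ : [set y | _] = set0) ?measure0//.
by rewrite -subset0 => y [].
Qed.

Section orthogonal_invariance.
Context {R : realType}.

Definition trot n (O : 'M[R]_n) (t : n.-tuple R) : n.-tuple R :=
  tuple_of_col (O *m col_of_tuple t).

Lemma measurable_trot n (O : 'M[R]_n) : measurable_fun setT (trot O).
Proof.
apply: measurable_tuple_of_col; apply: measurable_mulmx => i.
exact: measurable_col_of_tuple.
Qed.

Lemma col_of_taff n a (b t : n.-tuple R) :
  col_of_tuple (taff a b t) = a *: col_of_tuple t + col_of_tuple b.
Proof. by apply/matrixP => i j; rewrite !mxE tnth_mktuple. Qed.

Lemma lebesgue_n_shift n (b : n.-tuple R) (B : set (n.-tuple R)) :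
  measurable B -> lebesgue_n R n (taff 1 b @^-1` B) = lebesgue_n R n B.
Proof.
by move=> mB; rewrite lebesgue_n_taff ?oner_neq0// normr1 invr1 expr1n mul1e.
Qed.

(* Both sides are multiplied by the measure of the unit ball, which is
   invariant under O: Tonelli and translations then turn one into the other,
   as in the proof of the uniqueness of Haar measure. *)
Lemma shift_invariant_trot n (mu : {sigma_finite_measure set (n.-tuple R) -> \bar R})
    (O : 'M[R]_n) (B : set (n.-tuple R)) :
  (forall b C, measurable C -> mu (taff 1 b @^-1` C) = mu C) ->
  (0 < mu (unit_ball n))%E -> (mu (unit_ball n) < +oo)%E ->
  O^T *m O = 1%:M -> measurable B ->
  mu (trot O @^-1` B) = mu B.
Proof.
move=> mu_shift mu_gt0 mu_fin.
move=> OO mB; set D := @unit_ball R n; have mD : measurable D by exact: measurable_unit_ball.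
have mrB : measurable (trot O @^-1` B) by apply: measurable_fun_pre => //; exact: measurable_trot.
have OO' : O *m O^T = 1%:M by exact: mulmx1C.
pose add (x y : n.-tuple R) := taff 1 y x.
have colD x y : col_of_tuple (add x y) = col_of_tuple x + col_of_tuple y.
  by rewrite col_of_taff scale1r.
have colR x : col_of_tuple (trot O x) = O *m col_of_tuple x by rewrite tuple_of_colK.
pose opp (x : n.-tuple R) := taff (-1) [tuple (0 : R) | i < n] x.
have colN x : col_of_tuple (opp x) = - col_of_tuple x.
  rewrite col_of_taff scaleN1r (_ : col_of_tuple [tuple _ | _ < _] = 0) ?addr0//.
  by apply/matrixP => i j; rewrite !mxE tnth_mktuple.
have m1 i : measurable_fun setT (fun z : n.-tuple R * n.-tuple R => col_of_tuple z.1 i 0).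
  exact: (measurableT_comp (measurable_col_of_tuple i) measurable_fst).
have m2 i : measurable_fun setT (fun z : n.-tuple R * n.-tuple R => col_of_tuple z.2 i 0).
  exact: (measurableT_comp (measurable_col_of_tuple i) measurable_snd).
(* [E] asks that x be in the ball and x + O y in [B]; replacing x by x - O y turns it into [E'].
   Integrating first in y gives the two products to be compared, and integrating first in x shows
   that they are equal. *)
pose E := [set z : n.-tuple R * n.-tuple R | D z.1 /\ B (add z.1 (trot O z.2))].
pose E' := [set z : n.-tuple R * n.-tuple R | B z.1 /\ D (add z.1 (opp (trot O z.2)))].
have addE x y : add x y = tuple_of_col (col_of_tuple x + col_of_tuple y).
  by rewrite -colD col_of_tupleK.
have mE : measurable E.
  apply: (measurableI _ _ (measurable_fun_pre measurable_fst mD)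
    (measurable_fun_pre _ mB)).
  under eq_fun do rewrite addE colR.
  apply: measurable_tuple_of_col => i; under eq_fun do rewrite mxE.
  by apply: measurable_funD; [exact: m1|exact: (measurable_mulmx O m2)].
have mE' : measurable E'.
  apply: (measurableI _ _ (measurable_fun_pre measurable_fst mB)
    (measurable_fun_pre _ mD)).
  under eq_fun do rewrite addE colN colR.
  apply: measurable_tuple_of_col => i.
  under eq_fun do rewrite mxE [X in _ + X]mxE.
  apply: measurable_funB; [exact: m1|exact: (measurable_mulmx O m2)].
have FE := sigma_finite_swap mu mu mE.
have FE' := sigma_finite_swap mu mu mE'.
have L1 : (\int[mu]_x mu [set y | E (x, y)] =
    mu (trot O @^-1` B) * mu D)%E.
  have := @integral_measure_if _ _ _ _ _ mu mu D
    (fun x => [set y | B (add x (trot O y))]) (mu (trot O @^-1` B)) mD.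
  move=> h.
  apply: h; first exact: measure_ge0.
  move=> x.
  rewrite -(mu_shift (trot O^T x) _ mrB); congr (mu _).
  (* x + O y = O (y + O^T x), so the fibre over x is a translate of the preimage of [B]. *)
  have e y : trot O (taff 1 (trot O^T x) y) = add x (trot O y).
    rewrite addE colR /trot col_of_taff tuple_of_colK scale1r mulmxDr.
    by rewrite mulmxA OO' mul1mx addrC.
  by apply/seteqP; split => y /=; rewrite e.
have L2 : (\int[mu]_x mu [set y | E' (x, y)] =
    mu D * mu B)%E.
  have := @integral_measure_if _ _ _ _ _ mu mu B
    (fun x => [set y | D (add x (opp (trot O y)))]) (mu D) mB.
  move=> h.
  apply: h; first exact: measure_ge0.
  move=> x.
  rewrite -(mu_shift (opp (trot O^T x)) _ mD); congr (mu _).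
  (* x - O y and y - O^T x have the same length: this is where the invariance of the ball under [O]
     enters. *)
  have e y : dotp (col_of_tuple (add x (opp (trot O y))))
                  (col_of_tuple (add x (opp (trot O y)))) =
      dotp (col_of_tuple (taff 1 (opp (trot O^T x)) y))
           (col_of_tuple (taff 1 (opp (trot O^T x)) y)).
    rewrite colD colN colR -/(add y (opp (trot O^T x))) colD colN tuple_of_colK.
    rewrite -[RHS](dotp_mulmx _ _ OO) mulmxBr mulmxA OO' mul1mx.
    by rewrite -(opprB (O *m _)) dotpNl dotpNr opprK.
  by apply/seteqP; split => y /=; rewrite /D /unit_ball /= e.
have : (mu (trot O @^-1` B) * mu D =
        mu D * mu B)%E.
  rewrite -L1 -L2 FE FE'; apply: eq_integral => y _.
  have mEy : measurable [set x | E (x, y)].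
    by apply: measurable_fun_pre mE; exact: measurable_pair2.
  rewrite -(mu_shift (opp (trot O y)) _ mEy).
  have e x : add (add x (opp (trot O y))) (trot O y) = x.
    by rewrite addE colD colN subrK col_of_tupleK.
  have -> // : taff 1 (opp (trot O y)) @^-1` [set x | E (x, y)] =
    [set x | E' (x, y)].
  apply/seteqP; split => x; rewrite /preimage /E /E' /= -/(add x _) e => -[h1 h2];
    by split.
have Dfin : mu D \is a fin_num.
  by rewrite ge0_fin_numE.
rewrite muleC => DB; apply: le_anti.
by apply/andP; split; rewrite -(lee_pmul2l Dfin mu_gt0) DB lexx.
Qed.

Lemma lebesgue_n_trot n (O : 'M[R]_n) (B : set (n.-tuple R)) :
  O^T *m O = 1%:M -> measurable B ->
  lebesgue_n R n (trot O @^-1` B) = lebesgue_n R n B.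
Proof.
apply: shift_invariant_trot; first exact: lebesgue_n_shift.
  exact: lebesgue_n_unit_ball_gt0.
exact: lebesgue_n_unit_ball_fin.
Qed.

End orthogonal_invariance.

(** * The volume of a subset of the sphere and of its cone *)

(** The matrix with blocks 1, [v^T], [u], 1 is factored into block triangular matrices in two ways,
    and the determinants are compared. *)
Lemma det_1subrank1 (F : comUnitRingType) n (u v : 'cV[F]_n) :
  \det (1%:M - u *m v^T) = 1 - (v^T *m u) 0 0.
Proof.
have e : block_mx 1%:M 0 u 1%:M *m block_mx 1%:M (v^T) 0 (1%:M - u *m v^T) =
    block_mx (1%:M - v^T *m u) (v^T) 0 1%:M *m block_mx 1%:M 0 u 1%:M.
  rewrite !mulmx_block !mulmx1 !mul1mx !mulmx0 !mul0mx !addr0 !add0r.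
  by rewrite subrK addrC subrK.
have /= := congr1 (fun M => \det M) e.
rewrite !det_mulmx !det_lblock !det_ublock !det1 !mul1r !mulr1 => ->.
by rewrite det_mx11 !mxE eqxx.
Qed.

Section sphere_volume.
Context {R : realType}.

Lemma sqr_enorm m (x : 'cV[R]_m) : enorm x ^+ 2 = dotp x x.
Proof. by rewrite sqr_sqrtr// dotp_ge0. Qed.

Lemma enormZ m a (x : 'cV[R]_m) : enorm (a *: x) = `|a| * enorm x.
Proof. by rewrite /enorm dotpZl dotpZr mulrA -expr2 sqrtrM ?sqr_ge0// sqrtr_sqr. Qed.

(** The columns of the Jacobian are, up to sign, [e_i / w - y_i (1, y) / w^3]. Their Gram matrix is
    written as a scalar times a rank one perturbation of the identity, the shape that
    [det_1subrank1] expects. *)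
Lemma metric_gnomonic n e (y : 'cV[R]_n) :
  metric_mx (gnomonic e) y = (enorm (homog y) ^- 2) *:
    (1%:M - (enorm (homog y) ^- 2 *: y) *m y^T).
Proof.
set w := enorm (homog y).
have w0 : w != 0 by rewrite gt_eqF// enorm_homog_gt0.
have ww : dotp y y = w ^+ 2 - 1 by rewrite /w sqr_enorm dotp_homog addrC addKr.
apply/matrixP => i j; rewrite !mxE big_ord1 !mxE.
rewrite (eq_bigr (fun k : 'I_(1 + n) =>
  ((k == rshift 1 i)%:R / w - homog y k 0 * y i 0 / w ^+ 3) *
  ((k == rshift 1 j)%:R / w - homog y k 0 * y j 0 / w ^+ 3))); last first.
  move=> k _; rewrite mxE !jacobian_gnomonic mulrACA -expr2 sqrr_sign mul1r.
  by [].
rewrite big_split_ord big_ord1 /= !col_mxEu !mxE ?eq_lrshift eqxx.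
under eq_bigr => k _ do rewrite !col_mxEd !(inj_eq (@rshift_inj _ _)).
(* Splitting along the Kronecker symbols leaves three sums over [k]: two equal to 1, and one equal
   to [dotp y y], that is [w ^+ 2 - 1]. *)
have E k : (((k == i)%:R / w - y k 0 * y i 0 / w ^+ 3) *
    ((k == j)%:R / w - y k 0 * y j 0 / w ^+ 3)) =
  (k == i)%:R * ((i == j)%:R / w ^+ 2 - y i 0 * y j 0 / w ^+ 4) +
  ((k == j)%:R * (- (y i 0 * y j 0 / w ^+ 4)) +
   (y k 0 * y k 0) * (y i 0 * y j 0 / w ^+ 6)).
  have [->|ki] := eqVneq k i.
    by have [->|ij] := eqVneq i j; rewrite ?eqxx /=; field.
  by have [->|kj] := eqVneq k j; rewrite ?eqxx /=; field.
under eq_bigr => k _ do rewrite E.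
rewrite !big_split /= -!mulr_suml.
have S l : \sum_(k < n) (k == l)%:R = 1 :> R.
  by rewrite (bigD1 l)//= eqxx big1 ?addr0// => k /negbTE ->.
rewrite !S -/(dotp y y) ww; by field.
Qed.

(** The rank one perturbation has determinant [1 - |y|^2 / w^2 = w^-2], so the metric has
    determinant [w^(-2(n+1))]. *)
Lemma riemannian_density_gnomonic n e (y : 'cV[R]_n) :
  riemannian_density (gnomonic e) y = enorm (homog y) ^- n.+1.
Proof.
rewrite /riemannian_density metric_gnomonic detZ.
set w := enorm (homog y).
have w0 : 0 < w by rewrite enorm_homog_gt0.
rewrite det_1subrank1 -scalemxAr mxE -dotpE.
have -> : dotp y y = w ^+ 2 - 1 by rewrite /w sqr_enorm dotp_homog addrC addKr.
have -> : (w ^- 2) ^+ n * (1 - w ^- 2 * (w ^+ 2 - 1)) = (w ^- n.+1) ^+ 2.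
  have -> : 1 - w ^- 2 * (w ^+ 2 - 1) = w ^- 2 by field; rewrite gt_eqF.
  by rewrite -!exprVn -exprSr exprAC.
by rewrite sqrtr_sqr ger0_norm// invr_ge0 exprn_ge0// ltW.
Qed.

Lemma integral_exprn n (r : R) : 0 < r ->
  (\int[lebesgue_measure]_(x in `]0%R, r]) (x ^+ n)%:E =
   (r ^+ n.+1 / n.+1%:R)%:E)%E.
Proof.
move=> r0.
rewrite integral_itv_obnd_cbnd; last first.
  by apply/measurable_EFinP; apply: measurable_funTS; exact: exprn_measurable.
pose G (x : R) : R := n.+1%:R^-1 * x ^+ n.+1.
have dG (x : R) : is_derive x (1 : R) G (x ^+ n).
  have dX : is_derive x (1 : R) (fun x : R => x ^+ n.+1) (n.+1%:R *: x ^+ n).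
    by split; [exact: exprn_derivable|rewrite exp_derive scaler1].
  apply: is_derive_eq (is_deriveM (is_derive_cst (n.+1%:R^-1 : R) x 1) dX) _.
  by rewrite /GRing.scale /= mulr0 addr0 mulrA mulVf ?mul1r// pnatr_eq0.
have cG (x : R) : {for x, continuous G}.
  by apply: differentiable_continuous; apply/derivable1_diffP; exact: ex_derive.
rewrite (@continuous_FTC2 _ _ G)//.
- by rewrite /G expr0n/= mulr0 sube0 mulrC.
- by apply: continuous_subspaceT; exact: exprn_continuous.
- split; first by move=> x _; exact: ex_derive.
  + by apply: cvg_at_right_filter; exact: cG.
  + by apply: cvg_at_left_filter; exact: cG.
- by move=> x _; rewrite derive1E; exact: derive_val.
Qed.

Lemma measurable_inv : measurable_fun setT (GRing.inv : R -> R).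
Proof.
rewrite -(setvU [set (0 : R)]); apply/measurable_funU => //.
  exact: measurableC.
split; last exact: measurable_fun_set1.
apply: open_continuous_measurable_fun; first by apply: closed_openC; exact: closed_eq.
by move=> x; rewrite inE /= => /eqP x0; exact: inv_continuous.
Qed.

End sphere_volume.

(** * Radial projection, truncated cones and their slices *)

Section sphere_cone.
Context {R : realType} {n : nat}.

Lemma dotp_sphere (p : sphere R n) : dotp (\val p) (\val p) = 1.
Proof.
have := valP p; rewrite inE /unit_sphere /= => p1.
by rewrite -sqr_enorm p1 expr1n.
Qed.

Lemma dotp1_sphere (x : 'cV[R]_n.+1) : dotp x x = 1 -> x \in unit_sphere R n.
Proof. by move=> x1; rewrite inE /unit_sphere /= /enorm x1 sqrtr1. Qed.

Lemma measurable_sphere d (T : measurableType d) (f : T -> sphere R n) :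
  (forall i, measurable_fun setT (fun t => \val (f t) i 0)) ->
  measurable_fun setT f.
Proof.
move=> mf; apply: (@measurability _ _ _ _ _ _ (@open (sphere R n))) => //.
move=> _ [_ [W oW <-] <-]; rewrite setTI.
exact: (measurable_open_preimage mf oW).
Qed.

Lemma measurable_sphere_coord (i : 'I_n.+1) :
  measurable_fun setT (fun p : sphere R n => \val p i 0).
Proof.
have cf : continuous (fun p : sphere R n => \val p i 0).
  move=> p; apply: (@continuous_comp _ _ _
    (fun p : sphere R n => \val p) (fun x : 'cV[R]_n.+1 => x i 0)).
    exact: initial_continuous.
  exact: coord_continuous.
apply: (measurability _ (RGenOpens.measurableE R)) => _ [_ [a [b ->] <-]].
rewrite setTI; apply: sub_sigma_algebra.
by move/continuousP : cf; apply; exact: interval_open.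
Qed.

(** The origin has no direction: there the value is the default [point]. *)
Definition normalize (x : 'cV[R]_n.+1) : sphere R n :=
  insubd (point : sphere R n) ((enorm x)^-1 *: x).

Lemma enorm_eq0 m (x : 'cV[R]_m) : (enorm x == 0) = (x == 0).
Proof. by rewrite -sqrf_eq0 sqr_enorm dotp_eq0. Qed.

Lemma val_normalize (x : 'cV[R]_n.+1) : x != 0 ->
  \val (normalize x) = (enorm x)^-1 *: x.
Proof.
move=> x0; rewrite val_insubd ifT//; apply: dotp1_sphere.
rewrite dotpZl dotpZr -sqr_enorm; field.
by rewrite enorm_eq0.
Qed.

Lemma val_normalizeE (x : 'cV[R]_n.+1) :
  \val (normalize x) = if x == 0 then \val (point : sphere R n)
                       else (enorm x)^-1 *: x.
Proof.
case: ifPn => [/eqP ->|]; last exact: val_normalize.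
rewrite val_insubd scaler0 ifN//; apply/negP; rewrite inE /unit_sphere /=.
by rewrite /enorm dotp0r sqrtr0 => /eqP; rewrite eq_sym oner_eq0.
Qed.

Lemma measurable_normalize :
  measurable_fun setT (fun t : n.+1.-tuple R => normalize (col_of_tuple t)).
Proof.
apply: measurable_sphere => i.
have mE : measurable_fun setT (fun t : n.+1.-tuple R =>
    dotp (col_of_tuple t) (col_of_tuple t)).
  by apply: measurable_dotp => j; exact: measurable_col_of_tuple.
rewrite (_ : (fun _ => _) = fun t => if dotp (col_of_tuple t) (col_of_tuple t) == 0
    then \val (point : sphere R n) i 0
    else (enorm (col_of_tuple t))^-1 * col_of_tuple t i 0); last first.
  by apply/funext => t; rewrite val_normalizeE dotp_eq0; case: ifP => //; rewrite mxE.
apply: measurable_fun_ifT => //.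
  apply: (measurable_fun_bool true).
  rewrite setTI (_ : _ @^-1` _ = (fun t : n.+1.-tuple R =>
    dotp (col_of_tuple t) (col_of_tuple t)) @^-1` [set 0]); last first.
    by apply/seteqP; split => t /= /eqP.
  exact: measurable_fun_pre.
apply: measurable_funM; last exact: measurable_col_of_tuple.
apply: measurableT_comp; first exact: measurable_inv.
apply: measurableT_comp => //.
by apply: continuous_measurable_fun; exact: sqrt_continuous.
Qed.

(** The apex is excluded because [normalize] is only a default value there. *)
Definition cone (B : set (sphere R n)) : set (n.+1.-tuple R) :=
  [set t | [/\ col_of_tuple t != 0, unit_ball n.+1 t &
             B (normalize (col_of_tuple t))]].

Lemma measurable_cone B : measurable B -> measurable (cone B).
Proof.
move=> mB.
have -> : cone B = (fun t : n.+1.-tuple R =>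
    dotp (col_of_tuple t) (col_of_tuple t)) @^-1` (~` [set 0]) `&`
  (unit_ball n.+1 `&` (fun t => normalize (col_of_tuple t)) @^-1` B).
  apply/seteqP; split => t /= => [[t0 t1 Bt]|[t0 [t1 Bt]]].
    by split => //; apply/eqP; rewrite dotp_eq0.
  by split => //; rewrite -dotp_eq0; apply/eqP.
apply: measurableI; last apply: measurableI.
- apply: measurable_fun_pre; last exact: measurableC.
  by apply: measurable_dotp => j; exact: measurable_col_of_tuple.
- exact: measurable_unit_ball.
- by apply: measurable_fun_pre => //; exact: measurable_normalize.
Qed.

Lemma col_of_tcons_taff (x : R) (y : n.-tuple R) :
  col_of_tuple (tcons (x, taff x [tuple 0 | i < n] y)) =
  x *: homog (col_of_tuple y).
Proof.
apply/matrixP => i j; rewrite (ord1 j) [LHS]mxE [RHS]mxE.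
have [k ->|->] := unliftP ord0 i.
  rewrite tnthS /= tnth_mktuple tnth_mktuple addr0.
  have -> : lift ord0 k = rshift 1 k by exact/val_inj.
  by rewrite col_mxEd mxE.
rewrite tnth0; have -> : ord0 = lshift n (ord0 : 'I_1) by exact/val_inj.
by rewrite col_mxEu mxE eqxx mulr1.
Qed.

Lemma normalize_homog (x : R) (y : 'cV[R]_n) : x != 0 ->
  normalize (x *: homog y) = gnomonic_chart (0 < x) y.
Proof.
move=> x0.
have h0 : homog y != 0 by rewrite -enorm_eq0 gt_eqF// enorm_homog_gt0.
apply: val_inj; rewrite val_normalize ?scaler_eq0 ?negb_or ?x0//=.
rewrite /gnomonic scalerA enormZ; congr (_ *: _).
have w0 : enorm (homog y) != 0 by rewrite enorm_eq0.
have [xgt0|xlt0|x00] := ltrgtP 0 x; last by rewrite x00 eqxx in x0.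
  by rewrite gtr0_norm// expr0; field; rewrite w0 x0.
by rewrite ltr0_norm// expr1; field; rewrite w0 x0.
Qed.

Definition chart_slice (B : set (sphere R n)) (e : bool) (r : R) : set (n.-tuple R) :=
  [set y | r * enorm (homog (col_of_tuple y)) <= 1 /\
           B (gnomonic_chart e (col_of_tuple y))].

(** The points at height [x] are [(x, x y) = x (1, y)]: the slice is the image of the chart region
    under the homothety of ratio [x] in dimension [n], whence [|x|^n]. The sign of [x] selects the
    hemisphere. *)
Lemma cone_slice (B : set (sphere R n)) (x : R) : measurable B -> x != 0 ->
  lebesgue_n R n [set t | cone B (tcons (x, t))] =
  ((`|x| ^+ n)%:E * lebesgue_n R n (chart_slice B (0 < x)%R `|x|%R))%E.
Proof.
move=> mB x0.
have mS : measurable [set t : n.-tuple R | cone B (tcons (x, t))].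
  apply: measurable_fun_pre (measurable_cone mB).
  by apply: measurableT_comp; [exact: measurable_tcons|exact: measurable_pair1].
have := lebesgue_n_taff [tuple (0 : R) | i < n] x0 mS.
have -> : taff x [tuple 0 | i < n] @^-1` [set t | cone B (tcons (x, t))] =
    chart_slice B (0 < x) `|x|.
  have E y : unit_ball n.+1 (tcons (x, taff x [tuple 0 | i < n] y)) <->
      `|x| * enorm (homog (col_of_tuple y)) <= 1.
    rewrite /unit_ball /= col_of_tcons_taff -sqr_enorm enormZ.
    by rewrite -[X in _ <= X](expr1n _ 2%N) ler_pXn2r ?nnegrE ?mulr_ge0 ?sqrtr_ge0.
  apply/seteqP; split => y; rewrite /preimage /chart_slice /cone /=.
    by rewrite col_of_tcons_taff normalize_homog// => -[_ /E].
  rewrite col_of_tcons_taff normalize_homog// => -[/E h1 h2]; split => //.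
  by rewrite scaler_eq0 negb_or x0 -enorm_eq0 gt_eqF// enorm_homog_gt0.
move=> ->; rewrite muleA -EFinM -exprMn mulfV ?expr1n ?mul1e//.
by rewrite normr_eq0.
Qed.

End sphere_cone.

(** * Integration of the slices, and invariance of the volume under rotations *)

Section sphere_volume_cone.
Context {R : realType} {n : nat}.
Local Notation lam := (@lebesgue_measure R).
Local Notation w y := (enorm (homog (@col_of_tuple R n y))).

Lemma measurable_enorm_homog : measurable_fun setT (fun y : n.-tuple R => w y).
Proof.
apply: (measurableT_comp (f := (Num.sqrt : R -> R))).
  by apply: continuous_measurable_fun; exact: sqrt_continuous.
under eq_fun do rewrite dotp_homog.
apply: measurable_funD => //.
by apply: measurable_dotp => i; exact: measurable_col_of_tuple.
Qed.

(** Tonelli: for fixed [y] the admissible [x] fill []0, 1/w y]], over which [x ^+ n] integrates to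
    the density of the chart divided by [n + 1]. *)
Lemma radial_integral (Q : set (n.-tuple R)) : measurable Q ->
  (\int[lam]_(x in [set` `]0%R, +oo[]) ((x ^+ n)%:E *
      lebesgue_n R n [set y | (x * w y <= 1)%R /\ Q y]) =
   \int[lebesgue_n R n]_(y in Q) ((w y ^- n.+1 / n.+1%:R)%:E))%E.
Proof.
move=> mQ.
pose E := [set z : measurableTypeR R * n.-tuple R |
  [/\ 0 < z.1, z.1 * w z.2 <= 1 & Q z.2]].
have m1 : measurable_fun setT (fun z : measurableTypeR R * n.-tuple R => z.1 : R).
  exact: measurable_fst.
have m2 : measurable_fun setT (fun z : measurableTypeR R * n.-tuple R => w z.2).
  exact: (measurableT_comp measurable_enorm_homog measurable_snd).
have mE : measurable E.
  have -> : E = (fun z : measurableTypeR R * n.-tuple R => z.1 : R) @^-1` [set` `]0, +oo[] `&`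
     ((fun z : measurableTypeR R * n.-tuple R => z.1 * w z.2) @^-1` [set` `]-oo, 1]] `&`
      snd @^-1` Q).
    by apply/seteqP; split => z /=; rewrite !in_itv /= andbT; [case|case=> ? []].
  apply: measurableI; last apply: measurableI.
  - exact: measurable_fun_pre.
  - by apply: measurable_fun_pre => //; exact: measurable_funM.
  - by apply: measurable_fun_pre => //; exact: measurable_snd.
(* The absolute value makes nonnegativity immediate and changes nothing on [E]. *)
pose F (z : measurableTypeR R * n.-tuple R) : \bar R := (`|z.1| ^+ n * \1_E z)%:E.
have F0 z : (0 <= F z)%E by rewrite lee_fin mulr_ge0// exprn_ge0.
have mF : measurable_fun setT F.
  apply/measurable_EFinP; apply: measurable_funM => //.
  by apply: measurable_funX; apply: measurableT_comp.
have := @fubini_tonelli _ _ _ _ _ lam (lebesgue_n R n) F mF F0.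
have -> : (\int[lam]_x \int[lebesgue_n R n]_y F (x, y) =
    \int[lam]_(x in [set` `]0%R, +oo[]) ((x ^+ n)%:E *
      lebesgue_n R n [set y | (x * w y <= 1)%R /\ Q y]))%E.
  rewrite [RHS]integral_mkcond; apply: eq_integral => x _.
  rewrite patchE; case: ifPn => [|/negP]; rewrite inE /= in_itv /= andbT => x0.
    have mEx : measurable [set y : n.-tuple R | x * w y <= 1 /\ Q y].
      have -> : [set y : n.-tuple R | x * w y <= 1 /\ Q y] = [set y | E (x, y)].
        by apply/seteqP; split => y; rewrite /E /= => -[] // *; split.
      by apply: measurable_fun_pre mE; exact: measurable_pair1.
    rewrite -[X in lebesgue_n R n X]setIT -integral_indic//.
    rewrite -ge0_integralZl//; last 2 first.
    - by apply/measurable_EFinP.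
    - by rewrite lee_fin exprn_ge0// ltW.
    apply: eq_integral => y _; rewrite /F /= gtr0_norm// -EFinM; congr (_ * _)%:E.
    rewrite !indicE; congr (nat_of_bool _)%:R; apply/idP/idP; rewrite !inE /E /=.
      by case.
    by case.
  rewrite integral0_eq// => y _; rewrite /F /= indicE memNset ?mulr0//.
  by case.
move=> ->; rewrite [RHS]integral_mkcond; apply: eq_integral => y _.
rewrite patchE; have w0 : 0 < w y by exact: enorm_homog_gt0.
have wV0 : 0 < (w y)^-1 by rewrite invr_gt0.
case: ifPn => [|/negP]; rewrite inE => Qy; last first.
  by rewrite integral0_eq// => x _; rewrite /F /= indicE memNset ?mulr0//; case.
rewrite -exprVn -integral_exprn// [RHS]integral_mkcond.
apply: eq_integral => x _; rewrite patchE /F /= indicE.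
case: ifPn => [|/negP]; rewrite inE /= in_itv /= => x0; last first.
  rewrite memNset ?mulr0//; case=> /= x1 x2 _; apply: x0.
  by rewrite x1 /= -[leRHS]div1r ler_pdivlMr.
have /andP[x1 x2] := x0.
rewrite mem_set ?mulr1 ?gtr0_norm//; split => //=.
by rewrite -ler_pdivlMr// div1r.
Qed.

Lemma measurable_chart_preimage e (B : set (sphere R n)) : measurable B ->
  measurable [set y : n.-tuple R | B (gnomonic_chart e (col_of_tuple y))].
Proof.
by move=> mB; apply: measurable_fun_pre mB; exact: measurable_gnomonic_chart.
Qed.

Lemma lebesgue_n_cone (B : set (sphere R n)) : measurable B ->
  lebesgue_n R n.+1 (cone B) =
  (\sum_(e : bool) \int[lam]_(x in [set` `]0%R, +oo[]) ((x ^+ n)%:E *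
     lebesgue_n R n (chart_slice B e x)))%E.
Proof.
move=> mB; rewrite lebesgue_nS big_bool /=.
pose f x := lebesgue_n R n [set t | cone B (tcons (x, t))].
have mf : measurable_fun setT f by apply: measurable_lebesgue_n_section; exact: measurable_cone.
have f0 x : (0 <= f x)%E by exact: measure_ge0.
have mfD (D : set R) : measurable_fun (T := measurableTypeR R) D f.
  exact: (measurable_funTS mf).
(* The slice at height 0 lies over the great sphere that both charts miss; a single height is
   negligible. *)
rewrite -/f -(@integral_setD1 _ _ 0); [|exact: measurableD|exact: mfD].
have -> : [set: R] `\ 0 = [set` `]0, +oo[] `|` [set` `]-oo, 0[].
  apply/seteqP; split => x /=; rewrite !in_itv /= andbT.
    by move=> [_ /eqP x0]; case: (ltrgtP x 0) x0 => // *; [right|left].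
  by case=> x0; split => // /eqP; [rewrite gt_eqF|rewrite lt_eqF].
rewrite ge0_integral_setU//=; last first.
  apply/disj_setPS => x /=; rewrite !in_itv /= andbT => -[x1 x2].
  by have := lt_trans x1 x2; rewrite ltxx.
congr (_ + _)%E.
  apply: eq_integral => x; rewrite inE /= in_itv /= andbT => x0.
  by rewrite /f cone_slice ?gt_eqF// x0 gtr0_norm.
rewrite [LHS]integral_mkcond [RHS]integral_mkcond.
have N1 : (-1 : R) != 0 by rewrite oppr_eq0 oner_eq0.
have mg : measurable_fun setT (f \_ [set` `]-oo, 0[]).
  by apply/(measurable_restrictT _ _).1 => //; exact: measurable_funTS.
(* Negative heights are brought to []0, +oo[] by the reflection [x -> - x]; they produce the chart
   [false]. *)
have := ge0_integral_affine 0 N1 mg.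
rewrite normrN normr1 invr1 mul1e => <-; last first.
  by move=> x; apply: erestrict_ge0.
apply: eq_integral => x _; rewrite !patchE mulN1r addr0.
have -> : (- x \in [set` `]-oo, 0[]) = (x \in [set` `]0, +oo[]).
  by apply/idP/idP; rewrite !inE /= !in_itv /= andbT oppr_lt0.
case: ifPn => //; rewrite inE /= in_itv /= andbT => x0.
rewrite /f cone_slice ?oppr_eq0 ?gt_eqF// normrN gtr0_norm//.
by rewrite oppr_gt0 ltNge ltW.
Qed.

Lemma sphere_vol_cone (B : set (sphere R n)) : measurable B ->
  sphere_vol B = (n.+1%:R%:E * lebesgue_n R n.+1 (cone B))%E.
Proof.
move=> mB; rewrite lebesgue_n_cone// /sphere_vol ge0_sume_distrr; last first.
  move=> e _; apply: integral_ge0 => x; rewrite /= in_itv /= andbT => x0.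
  by rewrite mule_ge0// lee_fin exprn_ge0// ltW.
apply: eq_bigr => e _.
rewrite (radial_integral (measurable_chart_preimage e mB)).
have mW : measurable_fun setT (fun y : n.-tuple R => w y ^- n.+1 / n.+1%:R).
  apply: measurable_funM => //; apply: measurableT_comp; first exact: measurable_inv.
  by apply: measurable_funX; exact: measurable_enorm_homog.
rewrite -ge0_integralZl//=.
- apply: eq_integral => y _; rewrite riemannian_density_gnomonic -EFinM.
  by congr EFin; rewrite mulrC divfK// pnatr_eq0.
- exact: measurable_chart_preimage.
- by apply/measurable_EFinP; exact: measurable_funTS.
- by move=> y _; rewrite lee_fin divr_ge0// invr_ge0 exprn_ge0// sqrtr_ge0.
Qed.

Lemma sphere_vol_fin : (sphere_vol [set: sphere R n] < +oo)%E.
Proof.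
rewrite sphere_vol_cone// lte_mul_pinfty//.

apply: le_lt_trans (lebesgue_n_unit_ball_fin n.+1).
apply: le_measure; rewrite ?inE; last by move=> t [].
  exact: measurable_cone.
exact: measurable_unit_ball.
Qed.

(** Normalization commutes with [O], and [O] preserves the unit ball: the cone over the preimage is
    the preimage of the cone. *)
Lemma sphere_vol_orthogonal (O : 'M[R]_n.+1) (U : sphere R n -> sphere R n)
    (B : set (sphere R n)) :
  O^T *m O = 1%:M -> (forall p, \val (U p) = O *m \val p) -> measurable B ->
  sphere_vol (U @^-1` B) = sphere_vol B.
Proof.
move=> OO UE mB.
have mU : measurable_fun setT U.
  apply: measurable_sphere => i; under eq_fun do rewrite UE.
  by apply: measurable_mulmx => j; exact: measurable_sphere_coord.
have mUB : measurable (U @^-1` B) by exact: measurable_fun_pre.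
rewrite (sphere_vol_cone mUB) (sphere_vol_cone mB); congr (_ * _)%E.
rewrite -(lebesgue_n_trot OO (measurable_cone mB)); congr (lebesgue_n R n.+1 _).
have colR (t : n.+1.-tuple R) : col_of_tuple (trot O t) = O *m col_of_tuple t.
  by rewrite tuple_of_colK.
have e1 (t : n.+1.-tuple R) : (O *m col_of_tuple t == 0) = (col_of_tuple t == 0).
  by rewrite -[LHS]dotp_eq0 dotp_mulmx// dotp_eq0.
have e2 (t : n.+1.-tuple R) : col_of_tuple t != 0 ->
    normalize (O *m col_of_tuple t) = U (normalize (col_of_tuple t)).
  move=> t0; apply: val_inj; rewrite UE !val_normalize ?e1//.
  by rewrite /enorm dotp_mulmx// scalemxAr.
apply/seteqP; split => t; rewrite /preimage /cone /unit_ball /= !colR dotp_mulmx// e1.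
  by move=> [t0 t1 Bt]; split => //; rewrite e2.
by move=> [t0 t1]; rewrite e2.
Qed.

End sphere_volume_cone.

(** * The geodesic distance *)

Section antiderivative.
Context {R : realType}.
Local Notation mu := (@lebesgue_measure R).

Lemma antiderivative (f : R -> R) (a b : R) : a < b ->
  {within `[a, b], continuous f} ->
  exists F : R -> R, [/\ {within `[a, b], continuous F},
    forall x, a < x < b -> is_derive x (1 : R) F (f x),
    F a = 0 & F b = \int[mu]_(t in `[a, b]) f t].
Proof.
move=> ab cf.
have fi : mu.-integrable `[a, b] (EFin \o f).
  by apply: continuous_compact_integrable => //; exact: segment_compact.
exists (fun x => \int[mu]_(t in `[a, x]) f t); split => //.
- exact: (parameterized_integral_continuous (ltW ab) fi).
- move=> x /andP[ax xb].
  have cfx : {for x, continuous f}.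
    by apply: (within_continuous_continuous ab cf); rewrite in_itv /= ax.
  have [d <-] := continuous_FTC1_closed xb fi ax cfx.
  by rewrite derive1E; exact: derivableP.
- by rewrite set_itv1 Rintegral_set1.
Qed.

End antiderivative.

Section vector_derivatives.
Context {R : realType}.

Lemma derivable_coord m (g : R -> 'cV[R]_m) (t : R) i : derivable g t 1 ->
  is_derive t (1 : R) (fun s => g s i 0) (derive1 g t i 0).
Proof.
move=> dg; have di := (derivable_mxP g t 1).1 dg i 0.
by split => //; rewrite derive1E derive_mx// mxE.
Qed.

Lemma is_derive_dotp m (f g : R -> 'cV[R]_m) (t : R) (df dg : 'cV[R]_m) :
  (forall i, is_derive t (1 : R) (fun s => f s i 0) (df i 0)) ->
  (forall i, is_derive t (1 : R) (fun s => g s i 0) (dg i 0)) ->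
  is_derive t (1 : R) (fun s => dotp (f s) (g s)) (dotp df (g t) + dotp (f t) dg).
Proof.
move=> hf hg.
have h i : is_derive t (1 : R) (fun s => f s i 0 * g s i 0)
    (f t i 0 *: dg i 0 + g t i 0 *: df i 0).
  exact: (is_deriveM (hf i) (hg i)).
have := is_derive_sum h.
rewrite (_ : \sum_(i < m) _ = (fun s => dotp (f s) (g s))); last first.
  by apply/funext => s; rewrite fct_sumE.
move=> hs; apply: is_derive_eq hs _.
rewrite big_split addrC /=; congr (_ + _).
by apply: eq_bigr => i _; rewrite /GRing.scale /= mulrC.
Qed.

(** Expanding the squared length of [dotp y y *: x - dotp x y *: y] gives the defect of the
    inequality times [dotp y y]. *)
Lemma cauchy_schwarz m (x y : 'cV[R]_m) : dotp x y ^+ 2 <= dotp x x * dotp y y.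
Proof.
have [->|y0] := eqVneq y 0; first by rewrite !dotp0r expr0n mulr0.
have yy : 0 < dotp y y by rewrite lt_neqAle eq_sym dotp_eq0 y0 dotp_ge0.
have := dotp_ge0 (dotp y y *: x - dotp x y *: y).
have -> : dotp (dotp y y *: x - dotp x y *: y) (dotp y y *: x - dotp x y *: y) =
   dotp y y * (dotp x x * dotp y y - dotp x y ^+ 2).
  rewrite dotpDl !dotpDr !dotpNl !dotpNr !dotpZl !dotpZr (dotpC y x); ring.
by rewrite pmulr_rge0// subr_ge0.
Qed.

Lemma continuous_mx (T : topologicalType) m (g : T -> 'cV[R]_m) :
  (forall i, continuous (fun t => g t i 0)) -> continuous g.
Proof.
move=> cg t; apply/cvg_ballP => e e0.
have : \forall s \near t, forall i, ball (g t i 0) e (g s i 0).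
  by apply: filter_forall => i; move/cvg_ballP : (cg i t) => /(_ e e0).
by apply: filterS => s h; split=> // i j; rewrite (ord1 j); exact: h.
Qed.

Lemma continuous_sum (T : topologicalType) (I : Type) (r : seq I) (f : I -> T -> R) :
  (forall i, continuous (f i)) -> continuous (fun t => \sum_(i <- r) f i t).
Proof.
move=> cf; elim: r => [|i r IH] t.
  by under eq_fun do rewrite big_nil; exact: cvg_cst.
under eq_fun do rewrite big_cons.
by apply: cvgD; [exact: cf|exact: IH].
Qed.

Lemma continuous_enorm m (g : R -> 'cV[R]_m) :
  continuous g -> continuous (fun t => enorm (g t)).
Proof.
move=> cg t; apply: (continuous_comp (f := fun s => dotp (g s) (g s))) => //.
  apply: continuous_sum => i s.
  have ci : {for s, continuous (fun s => g s i 0)}.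
    apply: (continuous_comp (f := g) (g := fun M : 'cV[R]_m => M i 0)).
      exact: cg.
    exact: coord_continuous.
  exact: cvgM.
exact: sqrt_continuous.
Qed.

End vector_derivatives.

Section geodesic.
Context {R : realType} {n : nat}.
Implicit Types p q : sphere R n.

Lemma dotp_sphere_itv p q : -1 <= dotp (\val p) (\val q) <= 1.
Proof.
have := cauchy_schwarz (\val p) (\val q).
by rewrite !dotp_sphere mulr1 => h; apply/andP; split; nra.
Qed.

Lemma curve_length_ge0 (g : R -> 'cV[R]_n.+1) : 0 <= curve_length g.
Proof. by apply: Rintegral_ge0 => t _; exact: sqrtr_ge0. Qed.

(* Scaling the height <p, g t> by c < 1 keeps acos differentiable, and the
   scaled angle still moves at most as fast as g. *)
Lemma acos_scaled_le (p q : sphere R n) (c : R) (g : R -> 'cV[R]_n.+1) :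
  sphere_curve p q g -> 0 < c < 1 ->
  acos (c * dotp (\val p) (\val q)) <= acos c + curve_length g.
Proof.
move=> [dg cg' g0 g1 gS] /andP[c0 c1].
pose h t := dotp (\val p) (g t).
have gg t : 0 <= t <= 1 -> dotp (g t) (g t) = 1.
  by move=> /gS; rewrite /unit_sphere /= => gt1; rewrite -sqr_enorm gt1 expr1n.
have dh (t : R) : is_derive t (1 : R) h (dotp (\val p) (derive1 g t)).
  have dp i : is_derive t (1 : R) (fun=> \val p i 0) ((0 : 'cV[R]_n.+1) i 0).
    by rewrite mxE; exact: is_derive_cst.
  have dgi i := derivable_coord i (dg t).
  by apply: is_derive_eq (is_derive_dotp dp dgi) _; rewrite dotpC dotp0r add0r.
have hle t : 0 <= t <= 1 -> h t ^+ 2 <= 1.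
  move=> t01; have := cauchy_schwarz (\val p) (g t).
  by rewrite dotp_sphere gg// mulr1.
have chlt t : 0 <= t <= 1 -> (c * h t) ^+ 2 < 1.
  move=> t01; rewrite exprMn (@le_lt_trans _ _ (c ^+ 2))//.
    by rewrite ler_piMr ?sqr_ge0// hle.
  by rewrite exprn_ilt1// ltW.
have chitv t : 0 <= t <= 1 -> -1 < c * h t < 1.
  by move=> /chlt ch1; apply/andP; split; nra.
pose f t := acos (c * h t).
have df (t : R) : 0 <= t <= 1 -> is_derive t (1 : R) f
    (- (Num.sqrt (1 - (c * h t) ^+ 2))^-1 * (c * dotp (\val p) (derive1 g t))).
  move=> t01; apply: (is_derive1_comp (f := @acos R)).
  exact/is_derive1_acos/chitv.
have cs : continuous (fun t => enorm (derive1 g t)) by exact: continuous_enorm.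
have [F [cF dF F0 F1]] := antiderivative ltr01 (continuous_subspaceT cs).
have dfF (t : R) : t \in `]0, 1[ -> is_derive t (1 : R) (f - F)
    (- (Num.sqrt (1 - (c * h t) ^+ 2))^-1 * (c * dotp (\val p) (derive1 g t))
     - enorm (derive1 g t)).
  rewrite in_itv /= => /[dup] t01 /andP[t0 t1].
  by apply: is_deriveB; [apply: df; rewrite !ltW|exact: dF].
(* [F] is the arc length of [g], so the claim is that [f] minus the arc length does not increase. *)
have : (f - F) 1 <= (f - F) 0.
  apply: (@ler0_derive1_le_cc _ (f - F) 0 1); rewrite ?in_itv /= ?lexx ?ler01//.
  - by move=> t /dfF ?; exact: ex_derive.
  - move=> t t01; rewrite derive1E (derive_val (is_derive := dfF t t01)).
    move: t01; rewrite in_itv /= => /andP[t0 t1].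
    have t01 : 0 <= t <= 1 by rewrite !ltW.
    rewrite subr_le0; set s := Num.sqrt _; set v := derive1 g t.
    have s0 : 0 < s by rewrite sqrtr_gt0 subr_gt0 chlt.
    (* The velocity is tangent to the sphere: [dotp (g u) (g u)] is constant near the interior time
       [t]. *)
    have gv : dotp (g t) v = 0.
      have dgi i := derivable_coord i (dg t).
      have [_ d2] := is_derive_dotp dgi dgi.
      have e1 : \forall u \near t, dotp (g u) (g u) = 1.
        have t01' : t \in `]0, 1[ by rewrite in_itv /= t0.
        near=> u; apply: gg; have : u \in `]0, 1[ by near: u; exact: near_in_itvoo.
        by rewrite in_itv /= => /andP[u0 u1]; rewrite !ltW.
      have := near_eq_derive (1 : R) e1.
      rewrite d2 -/v (dotpC v) -mulr2n derive_cst => /eqP.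
      by rewrite mulrn_eq0 /= => /eqP.
    set d := dotp (\val p) v.
    (* As [v] is orthogonal to [g t], the point [p] can be replaced by its component orthogonal to
       [g t], of squared length [1 - h t ^+ 2]. *)
    have dle : d ^+ 2 <= (1 - h t ^+ 2) * dotp v v.
      have := cauchy_schwarz (\val p - h t *: g t) v.
      rewrite dotpDl dotpNl dotpZl gv mulr0 subr0 -/d.
      congr (_ <= _ * _); rewrite dotpDl !dotpDr !dotpNl !dotpNr !dotpZl !dotpZr.
      by rewrite dotp_sphere gg// (dotpC (g t)) -/(h t); ring.
    (* From [c ^+ 2 <= 1] follows [c^2 (1 - h^2) <= 1 - (c h)^2], which is [s ^+ 2]. *)
    have cdle : (c * d) ^+ 2 <= (s * enorm v) ^+ 2.
      rewrite !exprMn sqr_enorm sqr_sqrtr; last by rewrite subr_ge0 ltW// chlt.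
      apply: (@le_trans _ _ (c ^+ 2 * ((1 - h t ^+ 2) * dotp v v))).
        by rewrite ler_wpM2l// sqr_ge0.
      rewrite mulrA ler_wpM2r ?dotp_ge0// mulrBr mulr1 -exprMn lerD2r.
      by rewrite expr_le1// ltW.
    rewrite -(ler_pM2l s0) mulNr mulrN mulrA mulfV ?gt_eqF// mul1r.
    apply: le_trans (ler_norm _) _; rewrite normrN.
    rewrite -(@ler_pXn2r _ 2)// ?nnegrE ?mulr_ge0 ?sqrtr_ge0 ?(ltW s0)//.
    by rewrite real_normK ?num_real.
  - apply: within_continuousB => //.
    apply: derivable_within_continuous => t; rewrite in_itv /= => t01.
    by apply: (@ex_derive _ _ _ _ _ _ _ (df t t01)).
rewrite /f -[X in X <= _]/(acos (c * h 1) - F 1) -[X in _ <= X]/(acos (c * h 0) - F 0).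
rewrite F0 F1 /h g1 g0 dotp_sphere subr0 mulr1 lerBlDr.
exact.
Unshelve. all: by end_near. Qed.

End geodesic.

(** * Great circles realize the distance *)

Section geodesic_distance.
Context {R : realType} {n : nat}.
Implicit Types p q : sphere R n.

Definition angle p q : R := acos (dotp (\val p) (\val q)).

Lemma cos_angle p q : cos (angle p q) = dotp (\val p) (\val q).
Proof. by rewrite acosK// in_itv /= dotp_sphere_itv. Qed.

Lemma angle_itv p q : 0 <= angle p q <= pi.
Proof. by rewrite acos_ge0 ?dotp_sphere_itv// acos_lepi// dotp_sphere_itv. Qed.

Lemma le_cos (x y : R) : 0 <= x <= pi -> 0 <= y <= pi -> (cos y <= cos x) = (x <= y).
Proof. by move=> x0 y0; rewrite !leNgt ltr_cos// in_itv. Qed.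

Lemma le_acos (x y : R) : -1 <= x <= 1 -> -1 <= y <= 1 -> (acos y <= acos x) = (x <= y).
Proof.
move=> x1 y1; rewrite -le_cos ?acosK ?in_itv//.
  by rewrite acos_ge0// acos_lepi.
by rewrite acos_ge0// acos_lepi.
Qed.

(** Let [c] tend to 1 in [acos_scaled_le]. With [c = cos e] the bound becomes
    [cos (L + e) <= cos e * h], that is [0 <= k e], which passes to the limit at [e = 0]. *)
Lemma angle_le_curve_length p q g : sphere_curve p q g -> angle p q <= curve_length g.
Proof.
move=> gC; set L := curve_length g.
have L0 : 0 <= L by exact: curve_length_ge0.
have [Lpi|Lpi] := leP pi L; first by apply: le_trans Lpi; have /andP[] := angle_itv p q.
rewrite -le_cos; [|exact: angle_itv|by rewrite L0 ltW].
rewrite cos_angle; set h := dotp _ _; rewrite -subr_ge0.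
have h1 : -1 <= h <= 1 by exact: dotp_sphere_itv.
pose k (e : R) := cos e * h - cos (L + e).
have ck : {for 0, continuous k}.
  apply: cvgB.
    by apply: cvgM; [exact: continuous_cos|exact: cvg_cst].
  apply: (continuous_comp (f := fun e => L + e)); last exact: continuous_cos.
  by apply: cvgD; [exact: cvg_cst|exact: cvg_id].
have k0 : k 0 = h - cos L by rewrite /k cos0 mul1r addr0.
rewrite -k0; have kr : k e @[e --> 0^'+] --> k 0 by exact: cvg_at_right_filter.
rewrite -(cvg_lim _ kr)//; apply: limr_ge; first by apply/cvg_ex; exists (k 0).
(* [e < pi - L] keeps [L + e] in the range where the cosine decreases, and [e < pi / 2] makes
   [cos e] positive. *)
have d0 : 0 < Num.min (pi - L) (pi / 2) by rewrite lt_min subr_gt0 Lpi divr_gt0// pi_gt0.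
near=> e.
have e0 : 0 < e by [].
have : e < Num.min (pi - L) (pi / 2) by near: e; exact: nbhs_right_lt.
rewrite lt_min => /andP[eL epi].
have pi0 := pi_gt0 R.
have epi' : e < pi by lra.
have c1 : 0 < cos e < 1.
  rewrite cos_gt0_pihalf ?epi ?andbT/=; last by lra.
  by rewrite -[ltRHS]cos0 ltr_cos ?in_itv /= ?lexx ?(ltW pi0) ?(ltW e0) ?(ltW epi').
have /andP[c0 c1'] := c1; have /andP[h1' h2'] := h1.
have := acos_scaled_le gC c1; rewrite -/h -/L cosK; last by rewrite in_itv /= !ltW.
have chb : -1 <= cos e * h <= 1 by apply/andP; split; nra.
rewrite -le_cos; last 2 first.
- by rewrite acos_ge0// acos_lepi.
- by apply/andP; split; lra.
by rewrite acosK ?in_itv// addrC -subr_ge0.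
Unshelve. all: by end_near. Qed.

(** The ambient dimension is at least 2: the first two coordinates [(a, b)] of [p] are turned by a
    right angle into [(- b, a)]. If [a = 0] the first basis vector is already orthogonal to [p]. *)
Lemma orthogonal_unit_exists (n_ge1 : (1 <= n)%N) p :
  exists w : 'cV[R]_n.+1, dotp (\val p) w = 0 /\ dotp w w = 1.
Proof.
suff [w [pw w0]] : exists w : 'cV[R]_n.+1, dotp (\val p) w = 0 /\ w != 0.
  have ew : enorm w != 0 by rewrite enorm_eq0.
  exists ((enorm w)^-1 *: w); rewrite dotpZr pw mulr0 dotpZl dotpZr -sqr_enorm.
  by split => //; field.
pose i0 : 'I_n.+1 := ord0; pose i1 : 'I_n.+1 := lift ord0 (Ordinal n_ge1).
have i01 : i1 != i0 by [].
pose x := \val p; pose a := x i0 0; pose b := x i1 0.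
have dd (u : 'cV[R]_n.+1) i : dotp u (delta_mx i 0) = u i 0.
  rewrite /dotp (bigD1 i)//= mxE !eqxx mulr1 big1 ?addr0// => j ji.
  by rewrite mxE (negbTE ji) mulr0.
have [a0|a0] := eqVneq a 0.
  exists (delta_mx i0 0); rewrite dd; split => //.
  by apply/negP => /eqP/matrixP/(_ i0 0); rewrite !mxE !eqxx => /eqP; rewrite oner_eq0.
exists (a *: delta_mx i1 0 - b *: delta_mx i0 0); split.
  by rewrite dotpDr dotpNr !dotpZr !dd -/x -/a -/b; ring.
apply/negP => /eqP/matrixP/(_ i1 0); rewrite !mxE !eqxx (negbTE i01) /= mulr1 mulr0 subr0.
by move/eqP; rewrite (negbTE a0).
Qed.

Lemma great_circle (n_ge1 : (1 <= n)%N) p q :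
  exists w : 'cV[R]_n.+1, [/\ dotp (\val p) w = 0, dotp w w = 1 &
    \val q = cos (angle p q) *: \val p + sin (angle p q) *: w].
Proof.
set a := angle p q; have ca : cos a = dotp (\val p) (\val q) by exact: cos_angle.
have dpq : dotp (\val q - cos a *: \val p) (\val q - cos a *: \val p) = sin a ^+ 2.
  rewrite dotpDl !dotpDr !dotpNl !dotpNr !dotpZl !dotpZr !dotp_sphere (dotpC (\val q)).
  by rewrite -ca sin2cos2; ring.
(* If the sine vanishes, [q] is [p] or its antipode and the direction [w] is arbitrary; otherwise
   [w] comes from Gram-Schmidt. *)
have [sa|sa] := eqVneq (sin a) 0.
  have [w [pw ww]] := orthogonal_unit_exists n_ge1 p.
  exists w; split => //; rewrite sa scale0r addr0.
  by apply/eqP; rewrite -subr_eq0 -dotp_eq0 dpq sa expr0n.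
exists ((sin a)^-1 *: (\val q - cos a *: \val p)); split.
- by rewrite dotpZr dotpDr dotpNr dotpZr dotp_sphere mulr1 ca subrr mulr0.
- by rewrite dotpZl dotpZr dpq; field.
- by rewrite scalerA mulfV// scale1r addrC subrK.
Qed.

Lemma great_circle_curve p q (w : 'cV[R]_n.+1) (a : R) : 0 <= a ->
  dotp (\val p) w = 0 -> dotp w w = 1 -> \val q = cos a *: \val p + sin a *: w ->
  exists2 g, sphere_curve p q g & curve_length g = a.
Proof.
move=> a0 pw ww qE; pose x := \val p.
pose g (t : R) : 'cV[R]_n.+1 := cos (t * a) *: x + sin (t * a) *: w.
pose g' (t : R) : 'cV[R]_n.+1 := a *: (- sin (t * a) *: x + cos (t * a) *: w).
have dta (t : R) : is_derive t (1 : R) (fun s : R => s * a) a.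
  have did : is_derive (t : R) (1 : R) (id : R -> R) 1 by exact: is_derive_id.
  apply: is_derive_eq (is_deriveM did (is_derive_cst a _ _)) _.
  by rewrite /GRing.scale /=; ring.
have dgi (t : R) i : is_derive t (1 : R) (fun s => g s i 0) (g' t i 0).
  have dc : is_derive t (1 : R) (fun s => cos (s * a)) (- sin (t * a) * a).
    exact: (is_derive1_comp (f := @cos R)).
  have ds : is_derive t (1 : R) (fun s => sin (s * a)) (cos (t * a) * a).
    exact: (is_derive1_comp (f := @sin R)).
  have := is_deriveD (is_deriveM dc (is_derive_cst (x i 0) t 1))
                     (is_deriveM ds (is_derive_cst (w i 0) t 1)).
  rewrite (_ : _ + _ = fun s => g s i 0); last first.
    by apply/funext => s; rewrite /g !mxE.
  move=> h; apply: is_derive_eq h _.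
  by rewrite /g' !mxE /GRing.scale /=; ring.
have dg t : derivable g t (1 : R).
  by apply/derivable_mxP => i j; rewrite (ord1 j); exact: ex_derive.
have g'E : derive1 g = g'.
  apply/funext => t; rewrite derive1E derive_mx//; apply/matrixP => i j.
  by rewrite mxE (ord1 j); exact: derive_val.
have cta : continuous (fun t : R => t * a).
  by move=> t; apply: cvgM; [exact: cvg_id|exact: cvg_cst].
have cg' : continuous g'.
  apply: continuous_mx => i t; rewrite /g'.
  under eq_fun do rewrite !mxE.
  rewrite ?mxE; apply: cvgM; first exact: cvg_cst.
  apply: cvgD; apply: cvgM; try exact: cvg_cst.
    apply: cvgN; apply: (continuous_comp (f := fun t : R => t * a)); first exact: cta.
    exact: continuous_sin.
  apply: (continuous_comp (f := fun t : R => t * a)); first exact: cta.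
  exact: continuous_cos.
have xx : dotp x x = 1 by exact: dotp_sphere.
have wx : dotp w x = 0 by rewrite dotpC.
have cs (t : R) := cos2Dsin2 t.
exists g.
  split.
  - exact: dg.
  - by rewrite g'E; exact: cg'.
  - by rewrite /g mul0r cos0 sin0 scale1r scale0r addr0.
  - by rewrite /g mul1r qE.
  - move=> t _; rewrite /unit_sphere /= /enorm /g.
    rewrite dotpDl !dotpDr !dotpZl !dotpZr xx ww pw wx.
    rewrite (_ : _ + _ = cos (t * a) ^+ 2 + sin (t * a) ^+ 2); last by ring.
    by rewrite cs sqrtr1.
rewrite /curve_length g'E.
have -> : (fun t => enorm (g' t)) = cst a.
  apply/funext => t; rewrite /g' enormZ ger0_norm// /enorm.
  rewrite dotpDl !dotpDr !dotpZl !dotpZr xx ww pw wx.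
  rewrite (_ : _ + _ = cos (t * a) ^+ 2 + sin (t * a) ^+ 2); last by ring.
  by rewrite cs sqrtr1 mulr1.
rewrite Rintegral_cst//= lebesgue_measure_itv /= lte_fin ltr01 oppr0 adde0.
by rewrite mulr1.
Qed.

(** The lower bound on lengths is attained by an arc of great circle. On S^0 no curve joins
    antipodal points, and the infimum of the empty set is not their angle: hence [n_ge1]. *)
Lemma geodesic_distE (n_ge1 : (1 <= n)%N) p q : geodesic_dist p q = angle p q.
Proof.
have [w [pw ww qE]] := great_circle n_ge1 p q.
have /andP[a0 _] := angle_itv p q.
have [g gC gL] := great_circle_curve a0 pw ww qE.
have lb : lbound [set curve_length g | g in sphere_curve p q] (angle p q).
  by move=> _ [g1 g1C <-]; exact: angle_le_curve_length.
apply: le_anti; apply/andP; split.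
  by rewrite -[leRHS]gL; apply: ge_inf; [exists (angle p q)|exists g].
by apply: lb_le_inf => //; exists (curve_length g); exists g.
Qed.

End geodesic_distance.

(** * Potentials for the boost of an angle *)

Section boost_potential.
Context {R : realType}.

(* C and S stand for cosh s and sinh s, with s the parameter of the boost. *)
Definition mobius (C S c : R) : R := (S + C * c) / (C + S * c).

(** Equivalently, for [0 <= a < pi], the tangent of the half angle is multiplied by [e^-s]. *)
Definition boost_angle (C S a : R) : R := acos (mobius C S (cos a)).

Section mobius_theory.
Variables (C S : R).
Hypotheses (C0 : 0 < C) (CS : C ^+ 2 - S ^+ 2 = 1).

Lemma boost_sinh_lt : `|S| < C.
Proof.
rewrite -(@ltr_pXn2r _ 2)// ?nnegrE ?(ltW C0)// real_normK ?num_real//.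
by rewrite -subr_gt0 CS.
Qed.

Lemma mobius_den_gt0 c : -1 <= c <= 1 -> 0 < C + S * c.
Proof.
rewrite -ler_norml => c1; have : `|S * c| < C.
  by rewrite normrM (le_lt_trans _ boost_sinh_lt)// ler_piMr.
by rewrite ltr_norml -subr_gt0 => /andP[+ _]; rewrite opprK addrC.
Qed.

Lemma mobius_itv c : -1 <= c <= 1 -> -1 <= mobius C S c <= 1.
Proof.
move=> /[dup] c1 /mobius_den_gt0 d0; have /andP[c2 c3] := c1.
rewrite /mobius ler_pdivlMr// ler_pdivrMr//.
have := boost_sinh_lt; rewrite ltr_norml => /andP[S1 S2].
(* Up to the positive denominator, these products are [mobius C S c + 1] and [1 - mobius C S c]. *)
have h1 : 0 <= (C + S) * (1 + c) by apply: mulr_ge0; lra.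
have h2 : 0 <= (C - S) * (1 - c) by apply: mulr_ge0; lra.
by apply/andP; split; lra.
Qed.

(** The determinant of the homography is [C ^+ 2 - S ^+ 2 = 1]; its positivity makes the map
    increasing. *)
Lemma mobiusB c c' : -1 <= c <= 1 -> -1 <= c' <= 1 ->
  mobius C S c' - mobius C S c = (c' - c) / ((C + S * c) * (C + S * c')).
Proof.
move=> /mobius_den_gt0 d /mobius_den_gt0 d'; rewrite /mobius.
rewrite -[c' - c]mul1r -CS; field.
by rewrite !gt_eqF.
Qed.

Lemma le_mobius c c' : -1 <= c <= 1 -> -1 <= c' <= 1 ->
  (mobius C S c <= mobius C S c') = (c <= c').
Proof.
move=> c1 c1'; rewrite -subr_ge0 mobiusB// pmulr_lge0 ?subr_ge0//.
by rewrite invr_gt0 mulr_gt0// mobius_den_gt0.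
Qed.

Lemma mobiusK c : -1 <= c <= 1 -> mobius C (- S) (mobius C S c) = c.
Proof.
move=> /mobius_den_gt0 d; rewrite /mobius.
have -> : - S + C * ((S + C * c) / (C + S * c)) = c / (C + S * c).
  by rewrite -[RHS]mul1r -CS; field; rewrite gt_eqF.
have -> : C + - S * ((S + C * c) / (C + S * c)) = (C + S * c)^-1.
  by rewrite -[RHS]mul1r -CS; field; rewrite gt_eqF.
by field; rewrite gt_eqF.
Qed.

Lemma cos_itv (a : R) : -1 <= cos a <= 1.
Proof. by rewrite cos_geN1 cos_le1. Qed.

Lemma cos_boost_angle a : cos (boost_angle C S a) = mobius C S (cos a).
Proof. by rewrite acosK// in_itv /= mobius_itv// cos_itv. Qed.

Lemma boost_angle_itv a : 0 <= boost_angle C S a <= pi.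
Proof.
have := mobius_itv (cos_itv a) => m.
by rewrite acos_ge0// acos_lepi.
Qed.

Lemma le_boost_angle a b : 0 <= a <= pi -> 0 <= b <= pi ->
  (boost_angle C S a <= boost_angle C S b) = (a <= b).
Proof.
move=> a0 b0; rewrite -le_cos ?boost_angle_itv// !cos_boost_angle.
by rewrite le_mobius ?cos_itv// le_cos.
Qed.

End mobius_theory.

Lemma boost_angleK C S a : 0 < C -> C ^+ 2 - S ^+ 2 = 1 -> 0 <= a <= pi ->
  boost_angle C (- S) (boost_angle C S a) = a.
Proof.
move=> C0 CS a0; rewrite /boost_angle acosK ?in_itv /= ?mobius_itv ?cos_itv//.
by rewrite mobiusK ?cos_itv// cosK// in_itv.
Qed.

(** An increasing map of a segment onto a segment is continuous. This includes the end points, where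
    [acos] is not differentiable; preimages come from the opposite boost. *)
Lemma continuous_boost_angle C S : 0 < C -> C ^+ 2 - S ^+ 2 = 1 ->
  {within `[0, pi], continuous (boost_angle C S)}.
Proof.
move=> C0 CS; apply: segment_inc_surj_continuous.
  by move=> a b; rewrite !in_itv /= => a0 b0; rewrite le_boost_angle.
move=> b; rewrite /= in_itv /= => /andP[b1 b2].
have /andP[t0 _] := boost_angle_itv C0 CS 0.
have /andP[_ tp] := boost_angle_itv C0 CS pi.
have b0 : 0 <= b <= pi by rewrite (le_trans t0 b1) (le_trans b2 tp).
have CS' : C ^+ 2 - (- S) ^+ 2 = 1 by rewrite sqrrN.
exists (boost_angle C (- S) b); first by rewrite in_itv /= boost_angle_itv.
by have := boost_angleK C0 CS' b0; rewrite opprK.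
Qed.

(** The mean value theorem gives [F a - F b = boost_angle C S c * (a - b)] with [c] strictly
    between, and [boost_angle] is strictly increasing. This also reaches the end points, where [F]
    is only known to be continuous. *)
Lemma boost_convex_potential C S : 0 < C -> C ^+ 2 - S ^+ 2 = 1 ->
  exists F : R -> R, {within `[0, pi], continuous F} /\
    forall a b : R, 0 <= a <= pi -> 0 <= b <= pi -> a != b ->
      F b + boost_angle C S b * (a - b) < F a.
Proof.
move=> C0 CS; have ct := continuous_boost_angle C0 CS.
have [F [cF dF _ _]] := antiderivative (pi_gt0 R) ct.
exists F; split => // a b a0 b0.
have mvt (x y : R) : 0 <= x <= pi -> 0 <= y <= pi -> x < y ->
    exists2 c, x < c < y & F y - F x = boost_angle C S c * (y - x).
  move=> /andP[x0 xpi] /andP[y0 ypi] xy.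
  have dF' c : c \in `]x, y[ -> is_derive c (1 : R) F (boost_angle C S c).
    rewrite in_itv /= => /andP[xc cy]; apply: dF.
    by rewrite (le_lt_trans x0 xc) (lt_le_trans cy ypi).
  have cF' : {within `[x, y], continuous F}.
    apply: continuous_subspaceW cF => z /=; rewrite !in_itv /= => /andP[xz zy].
    by rewrite (le_trans x0 xz) (le_trans zy ypi).
  have [c cxy ->] := MVT xy dF' cF'.
  by exists c => //; rewrite in_itv /= in cxy.
have lt_t (x y : R) : 0 <= x <= pi -> 0 <= y <= pi -> x < y ->
    boost_angle C S x < boost_angle C S y.
  by move=> x0 y0; rewrite !ltNge le_boost_angle.
have mid (x y c : R) : 0 <= x <= pi -> 0 <= y <= pi -> x < c < y -> 0 <= c <= pi.
  move=> /andP[x0 _] /andP[_ y0] /andP[/ltW xc /ltW cy].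
  by rewrite (le_trans x0 xc) (le_trans cy y0).
case: (ltgtP a b) => // ab _.
  have [c /[dup] cab /andP[ac cb]] := mvt a b a0 b0 ab.
  have := lt_t c b (mid _ _ _ a0 b0 cab) b0 cb.
  move: (boost_angle C S c) (boost_angle C S b) => u v uv; nra.
have [c /[dup] cab /andP[ac cb]] := mvt b a b0 a0 ab.
have := lt_t b c b0 (mid _ _ _ b0 a0 cab) ac.
move: (boost_angle C S c) (boost_angle C S b) => u v uv; nra.
Qed.

(* psi is built by Legendre transform from the convex F with phi = a^2/2 - F, so
   that the defect of the inequality is the strict convexity gap of F. *)
Lemma boost_potentials C S : 0 < C -> C ^+ 2 - S ^+ 2 = 1 ->
  exists phi psi : R -> R, exists M : R,
  [/\ measurable_fun [set` `[0, pi]] phi, measurable_fun [set` `[0, pi]] psi,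
    forall a, 0 <= a <= pi -> `|phi a| <= M /\ `|psi a| <= M,
    forall a, 0 <= a <= pi ->
      phi a + psi (boost_angle C S a) = (a - boost_angle C S a) ^+ 2 / 2 &
    forall a b : R, 0 <= a <= pi -> 0 <= b <= pi -> b != boost_angle C S a ->
      phi a + psi b < (a - b) ^+ 2 / 2].
Proof.
move=> C0 CS; have [F [cF Flt]] := boost_convex_potential C0 CS.
have CS' : C ^+ 2 - (- S) ^+ 2 = 1 by rewrite sqrrN.
have ct' := continuous_boost_angle C0 CS'.
have ti a : 0 <= boost_angle C S a <= pi := boost_angle_itv C0 CS a.
have ti' a : 0 <= boost_angle C (- S) a <= pi := boost_angle_itv C0 CS' a.
have tK a : 0 <= a <= pi -> boost_angle C (- S) (boost_angle C S a) = a.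
  exact: boost_angleK.
have tK' a : 0 <= a <= pi -> boost_angle C S (boost_angle C (- S) a) = a.
  by move=> a0; have := boost_angleK C0 CS' a0; rewrite opprK.
have pi0 := pi_ge0 R.
have Fle a b : 0 <= a <= pi -> 0 <= b <= pi -> F b + boost_angle C S b * (a - b) <= F a.
  move=> a0 b0; have [->|ab] := eqVneq a b; first by rewrite subrr mulr0 addr0.
  exact/ltW/Flt.
(* The slopes of [F] are angles, hence nonnegative, so [F] stays between its end values. *)
have F_le a : 0 <= a <= pi -> F 0 <= F a <= F pi.
  move=> /[dup] a0 /andP[a1 a2]; apply/andP; split.
    have := Fle a 0 a0; rewrite lexx pi0 => /(_ isT).
    by have /andP[? ?] := ti 0; nra.
  have := Fle pi a; rewrite lexx pi0 a0 => /(_ isT isT).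
  by have /andP[? ?] := ti a; nra.
have mF : measurable_fun [set` `[0 : R, pi]] F.
  exact: subspace_continuous_measurable_fun.
have mt' : measurable_fun [set` `[0 : R, pi]] (boost_angle C (- S)).
  exact: subspace_continuous_measurable_fun.
pose t' := boost_angle C (- S).
exists (fun a => a ^+ 2 / 2 - F a).
(* The subtracted term is the Legendre transform of [F]: the supremum of [a * b - F a] is reached
   where the slope of [F] is [b], at [a = t' b]. *)
exists (fun b => b ^+ 2 / 2 - (b * t' b - F (t' b))).
exists (pi ^+ 2 * 2 + `|F 0| + `|F pi|); split.
- by apply: measurable_funB => //; apply: measurable_funM => //; apply: measurable_funX.
- apply: measurable_funB; first by apply: measurable_funM => //; apply: measurable_funX.
  apply: measurable_funB; first exact: measurable_funM.
  apply: (measurable_comp (F := [set` `[0, pi]]) (f := F)) => //.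
  by move=> _ [a _ <-]; rewrite /= in_itv /=.
- move=> a a0; have /andP[f1 f2] := F_le a a0.
  have /andP[g1 g2] := F_le (t' a) (ti' a); have /andP[t1 t2] := ti' a.
  have /andP[a1 a2] := a0.
  have n1 := ler_norm (F pi); have n2 := ler_norm (- F 0).
  have n3 := normr_ge0 (F pi); have n4 := normr_ge0 (F 0).
  rewrite normrN in n2; rewrite -/(t' a) in t1 t2.
  have aa : 0 <= a ^+ 2 <= pi ^+ 2 by rewrite sqr_ge0 ler_pXn2r.
  have at' : 0 <= a * t' a <= pi ^+ 2 by rewrite mulr_ge0//= expr2 ler_pM.
  move: aa at' => /andP[? ?] /andP[? ?].
  by split; rewrite ler_norml; apply/andP; split; lra.
- by move=> a a0; rewrite /t' tK//; field.
- move=> a b a0 b0 bt; have abt : a != t' b.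
    by apply: contra_neq bt => ->; rewrite tK'.
  have := Flt a (t' b) a0 (ti' b) abt; rewrite tK' //.
  lra.
Qed.

End boost_potential.

(** * The action of the exponential of a boost *)

Section boost_exponential.
Context {R : realType} {n : nat}.
Local Notation M := 'M[R]_(1 + n.+1).

Definition unit_boost (e : 'cV[R]_n.+1) : M := block_mx 0 e^T e 0.

(** [unit_boost e] exchanges [(1, 0)] and [(0, e)] and kills [(0, x)] for [x] orthogonal to [e]. *)
Lemma unit_boost_cube (e : 'cV[R]_n.+1) : dotp e e = 1 ->
  unit_boost e *m (unit_boost e *m unit_boost e) = unit_boost e.
Proof.
move=> e1; have ee : e^T *m e = 1%:M.
  by apply/matrixP => i j; rewrite (ord1 i) (ord1 j) -dotpE e1 mxE eqxx.
rewrite /unit_boost !mulmx_block !(mulmx0, mul0mx, addr0, add0r).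
by rewrite mulmxA !ee mul1mx mulmx1.
Qed.

(** Hyperbolic Rodrigues formula, with coefficients [cosh s - 1] and [sinh s]: the generator has
    eigenvalues 0, 1 and -1, and the series is summed on each eigenspace. *)
Lemma expm_unit_boost (e : 'cV[R]_n.+1) (s : R) : dotp e e = 1 ->
  expm (s *: unit_boost e) = 1%:M
    + ((expR s + expR (- s)) / 2 - 1) *: (unit_boost e *m unit_boost e)
    + ((expR s - expR (- s)) / 2) *: unit_boost e.
Proof.
move=> e1; set K := unit_boost e; pose Q := K *m K.
(* As K ^ 3 = K, the E b are idempotent and K acts on them as 1 and - 1. *)
have KQ : K *m Q = K by exact: unit_boost_cube.
pose E b := 2^-1 *: (Q + (-1) ^+ b *: K) : M.
have KE b : K *m E b = (-1) ^+ b *: E b.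
  rewrite /E -scalemxAr mulmxDr KQ -scalemxAr -/Q scalerA mulrC -scalerA.
  by congr (_ *: _); rewrite scalerDr scalerA -expr2 sqrr_sign scale1r addrC.
have EE : E false + E true = Q.
  rewrite /E -scalerDr expr0 expr1 scale1r scaleN1r addrACA subrr addr0.
  by rewrite -[Q + Q]mulr2n -[Q *+ 2]scaler_nat scalerA mulVf// scale1r.
have Ef : E false = 2^-1 *: (Q + K) by rewrite /E expr0 scale1r.
have Et : E true = 2^-1 *: (Q - K) by rewrite /E expr1 scaleN1r.
clearbody E.
(* [0 ^+ k] is 1 for [k = 0] only: the kernel follows the same pattern with eigenvalue 0, and its
   series sums to [expR 0]. *)
have XE k : (s *: K) ^+ k = 0 ^+ k *: (1%:M - Q) + s ^+ k *: E false + (- s) ^+ k *: E true.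
  elim: k => [|k IH].
    by rewrite !expr0 !scale1r -[RHS]addrA EE subrK.
  rewrite exprS IH; change (_ * _) with ((s *: K) *m
    (0 ^+ k *: (1%:M - Q) + s ^+ k *: E false + (- s) ^+ k *: E true)).
  rewrite !mulmxDr -!scalemxAr -!scalemxAl !KE mulmxBr mulmx1 KQ subrr !scaler0 add0r.
  rewrite expr0n /= scale0r add0r expr0 expr1 !scalerA mulr1 -!exprSr.
  by rewrite (exprSr (- s)) mulrN1 mulrN.
have cX (x : R) : series (exp_coeff x) @ \oo --> expR x.
  exact: is_cvg_series_exp_coeff.
rewrite /expm; apply: cvg_lim; first exact: norm_hausdorff.
have -> : series (fun k => k`!%:R^-1 *: (s *: K) ^+ k) =
    fun N => series (exp_coeff 0) N *: (1%:M - Q) + series (exp_coeff s) N *: E false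
      + series (exp_coeff (- s)) N *: E true.
  apply/funext => N; rewrite /series /= !scaler_suml -!big_split.
  apply: eq_bigr => k _; rewrite XE !scalerDr !scalerA /exp_coeff /=.
  by rewrite ![_^-1 * _]mulrC.
have -> : 1%:M + ((expR s + expR (- s)) / 2 - 1) *: Q + ((expR s - expR (- s)) / 2) *: K =
   expR 0 *: (1%:M - Q) + expR s *: E false + expR (- s) *: E true.
  by rewrite expR0 Ef Et; apply/matrixP => i j; rewrite !mxE; field.
have cZ (x : R) (B : M) : series (exp_coeff x) N *: B @[N --> \oo] --> expR x *: B.
  by apply: cvgZr_tmp; exact: cX.
exact: cvgD (cvgD (cZ 0 _) (cZ s _)) (cZ (- s) _).
Qed.

Lemma exp_boostsP (P : M) : exp_boosts R n P ->
  exists (C S : R) (e : sphere R n), [/\ 0 < C, C ^+ 2 - S ^+ 2 = 1 &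
    forall u : 'cV[R]_n.+1, P *m homog u =
      col_mx (C + S * dotp (\val e) u)%:M
             (u + (S + (C - 1) * dotp (\val e) u) *: \val e)].
Proof.
move=> [_ [v ->] <-].
have [e [s vE]] : exists (e : sphere R n) s, v = s *: \val e.
  (* For [v = 0] any axis will do, with [s = 0]. *)
  have [->|v0] := eqVneq v 0; first by exists point, 0; rewrite scale0r.
  exists (normalize v), (enorm v); rewrite val_normalize// scalerA mulfV ?scale1r//.
  by rewrite enorm_eq0.
exists ((expR s + expR (- s)) / 2), ((expR s - expR (- s)) / 2), e; split.
- by rewrite divr_gt0// addr_gt0// expR_gt0.
- have ee : expR s * expR (- s) = 1 by rewrite -expRD subrr expR0.
  by rewrite (_ : _ - _ = expR s * expR (- s))//; field.
move=> u; have -> : block_mx 0 v^T v 0 = s *: unit_boost (\val e).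
  by rewrite /unit_boost scale_block_mx !scaler0 vE linearZ.
rewrite expm_unit_boost ?dotp_sphere//.
set C := _ / 2; set S := _ / 2; set c := dotp _ _.
have eu : (\val e)^T *m u = c%:M.
  by apply/matrixP => i j; rewrite (ord1 i) (ord1 j) -dotpE mxE eqxx.
have e1 : (\val e)^T *m \val e = 1%:M.
  by apply/matrixP => i j; rewrite (ord1 i) (ord1 j) -dotpE dotp_sphere mxE eqxx.
have Ku (a : R) (x : 'cV[R]_n.+1) : unit_boost (\val e) *m col_mx a%:M x =
    col_mx ((\val e)^T *m x) (a *: \val e).
  rewrite /unit_boost mul_block_col !mul0mx add0r addr0.
  by rewrite mul_mx_scalar.
rewrite !mulmxDl mul1mx -!scalemxAl -mulmxA /homog Ku eu scale1r Ku e1.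
rewrite !scale_col_mx !add_col_mx; congr col_mx.
  by apply/matrixP => i j; rewrite !mxE !(ord1 i) !(ord1 j) eqxx; ring.
by apply/matrixP => i j; rewrite !mxE; ring.
Qed.

(** The first coordinate of [homog] is 1, so any other witness carries the same scalar [k]; thus
    [xget] can only choose [u']. *)
Lemma act_eq (A : M) (u u' : sphere R n) (k : R) : k != 0 ->
  A *m homog (\val u) = k *: homog (\val u') -> act A u = u'.
Proof.
move=> k0 Au; rewrite /act; case: xgetP => [w _ [l Al]|/(_ u') []]; last by exists k.
have := Au; rewrite Al /homog !scale_col_mx => /eq_col_mx[/matrixP/(_ 0 0) + lw].
rewrite !mxE eqxx !mulr1 => lk; rewrite lk in lw.
by apply: val_inj; exact: (scalerI k0 lw).
Qed.

Lemma val_act_so (O : 'M[R]_n.+1) (u : sphere R n) : O^T *m O = 1%:M ->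
  \val (act (so_embed O) u) = O *m \val u.
Proof.
move=> OO; have Ou : O *m \val u \in unit_sphere R n.
  by apply: dotp1_sphere; rewrite dotp_mulmx// dotp_sphere.
pose u' : sphere R n := exist _ (O *m \val u) Ou.
rewrite (@act_eq _ u u' 1) ?oner_neq0//.
by rewrite scale1r /so_embed /homog mul_block_col !mul0mx mulmx1 addr0 add0r.
Qed.

(** * Motion of points along meridians under a boost *)

Section boost_action.
Variables (P : M) (C S : R) (e : sphere R n).
Hypotheses (C0 : 0 < C) (CS : C ^+ 2 - S ^+ 2 = 1).
Hypothesis PE : forall u : 'cV[R]_n.+1, P *m homog u =
  col_mx (C + S * dotp (\val e) u)%:M
         (u + (S + (C - 1) * dotp (\val e) u) *: \val e).

Let den (u : sphere R n) := C + S * dotp (\val e) (\val u).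

Let den_gt0 u : 0 < den u.
Proof. exact/(mobius_den_gt0 C0 CS)/dotp_sphere_itv. Qed.

(** [den u] is the first coordinate of the image of [(1, u)]. The image stays on the light cone, so
    its other coordinates form a vector of length [den u], and division by [den u] returns to the
    sphere. *)
Lemma act_boostE u : P *m homog (\val u) = den u *: homog (\val (act P u)) /\
  \val (act P u) = (den u)^-1 *:
    (\val u + (S + (C - 1) * dotp (\val e) (\val u)) *: \val e).
Proof.
set c := dotp _ _; set k := S + _; set x := _ *: (_ + _).
have d0 : den u != 0 by rewrite gt_eqF.
have xS : x \in unit_sphere R n.
  apply: dotp1_sphere; rewrite /x dotpZl dotpZr dotpDl !dotpDr !dotpZl !dotpZr.
  rewrite !dotp_sphere (dotpC (\val u)) -/c.
  rewrite (_ : _ + _ = den u ^+ 2); first by field.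
  rewrite /den -/c /k.
  (* The last summand vanishes by [CS]; with it the equality is a polynomial identity. *)
  have -> : (C + S * c) ^+ 2 = 1 + 2 * (S * C * c) + (C ^+ 2 - 1) * c ^+ 2 + S ^+ 2
     + (C ^+ 2 - S ^+ 2 - 1) * (1 - c ^+ 2) by ring.
  by rewrite CS subrr mul0r addr0; ring.
have Px : P *m homog (\val u) = den u *: homog x.
  rewrite PE -/c -/k /homog scale_col_mx scalerA mulfV// scale1r; congr col_mx.
  by apply/matrixP => i j; rewrite !mxE (ord1 i) (ord1 j) mulr1n mulr1.
pose u' : sphere R n := exist _ x xS.
have -> : act P u = u' by apply: (@act_eq P u u' (den u) d0); exact: Px.
by [].
Qed.

Lemma dotp_act_boost u (y : 'cV[R]_n.+1) : dotp y (\val (act P u)) =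
  (dotp y (\val u) + (S + (C - 1) * dotp (\val e) (\val u)) * dotp y (\val e)) / den u.
Proof. by rewrite (act_boostE u).2 dotpZr dotpDr dotpZr mulrC. Qed.

(** The height of the image along [e] determines that of the point, as [mobius] is increasing. For
    equal heights both images use the same scaling and the same translation along [e], which
    cancel. *)
Lemma act_boost_inj : injective (act P).
Proof.
move=> u v uv; apply: val_inj; have := (act_boostE u).2; rewrite uv (act_boostE v).2.
have den1 w : dotp (\val e) (\val (act P w)) = mobius C S (dotp (\val e) (\val w)).
  by rewrite dotp_act_boost dotp_sphere /mobius -/(den w); congr (_ / _); ring.
have cuv : dotp (\val e) (\val u) = dotp (\val e) (\val v).
  apply: le_anti; have := congr1 (fun w => dotp (\val e) (\val w)) uv; rewrite /= !den1.
  move=> m; apply/andP; split;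
    by rewrite -(le_mobius C0 CS) ?dotp_sphere_itv// m.
rewrite /den cuv => /scalerI h; apply/esym; apply: (addIr _ (h _)).
by rewrite invr_eq0 gt_eqF// -cuv den_gt0.
Qed.

Lemma angle_act_boost u : angle e (act P u) = boost_angle C S (angle e u).
Proof.
rewrite /boost_angle cos_angle /angle dotp_act_boost dotp_sphere /mobius -/(den u).
by congr (acos (_ / _)); ring.
Qed.

Lemma measurable_act_boost : measurable_fun setT (act P).
Proof.
have md : measurable_fun setT (fun u : sphere R n => dotp (\val e) (\val u)).
  by apply: measurable_dotp => i //; exact: measurable_sphere_coord.
apply: measurable_sphere => i.
under eq_fun do rewrite (act_boostE _).2 mxE mxE [X in _ + X]mxE.
apply: measurable_funM.
  apply: measurableT_comp; first exact: measurable_inv.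
  by apply: measurable_funD => //; apply: measurable_funM.
apply: measurable_funD; first exact: measurable_sphere_coord.
apply: measurable_funM => //; apply: measurable_funD => //.
exact: measurable_funM.
Qed.

(** Cauchy-Schwarz for the components of [x] and [y] orthogonal to [e], whose lengths are the sines
    of the angles. *)
Lemma dotp_le_cos_angleB (x y : sphere R n) :
  dotp (\val x) (\val y) <= cos (angle e x - angle e y).
Proof.
have /andP[x0 xpi] := angle_itv e x; have /andP[y0 ypi] := angle_itv e y.
have sx : 0 <= sin (angle e x) by rewrite sin_ge0_pi// x0.
have sy : 0 <= sin (angle e y) by rewrite sin_ge0_pi// y0.
rewrite cosB !cos_angle -lerBlDl.
set cx := dotp (\val e) _; set cy := dotp (\val e) _.
apply: le_trans (ler_norm _) _.
rewrite -(@ler_pXn2r _ 2)// ?nnegrE ?mulr_ge0// real_normK ?num_real// exprMn.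
rewrite !sin2cos2 !cos_angle -/cx -/cy.
have := cauchy_schwarz (\val x - cx *: \val e) (\val y - cy *: \val e).
rewrite !dotpDl !dotpDr !dotpNl !dotpNr !dotpZl !dotpZr !dotp_sphere.
rewrite (dotpC (\val x) (\val e)) (dotpC (\val y) (\val e)) -/cx -/cy.
by congr (_ <= _); ring.
Qed.

Lemma dotp_act_boost_cos x :
  dotp (\val x) (\val (act P x)) = cos (angle e x - angle e (act P x)).
Proof.
have d0 := den_gt0 x.
have sx : 0 <= sin (angle e x) by rewrite sin_ge0_pi// angle_itv.
have sy : 0 <= sin (angle e (act P x)) by rewrite sin_ge0_pi// angle_itv.
set c := dotp (\val e) (\val x).
have cy : cos (angle e (act P x)) = mobius C S c.
  by rewrite angle_act_boost (cos_boost_angle C0 CS) cos_angle.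
(* Both sides are nonnegative, and [1 - mobius C S c ^+ 2] is [(1 - c ^+ 2) / den x ^+ 2]. *)
have sE : sin (angle e (act P x)) = sin (angle e x) / den x.
  apply/eqP; rewrite -(@eqrXn2 _ 2)// ?divr_ge0 ?(ltW d0)//; apply/eqP.
  rewrite [RHS]expr_div_n !sin2cos2 cy cos_angle -/c.
  transitivity (((C ^+ 2 - S ^+ 2) * (1 - c ^+ 2)) / den x ^+ 2).
    by rewrite /mobius -/(den x) /den -/c; field; rewrite gt_eqF.
  by rewrite CS mul1r.
rewrite cosB sE cy cos_angle -/c mulrA -expr2 sin2cos2 cos_angle -/c dotp_act_boost.
rewrite dotp_sphere (dotpC (\val x)) -/c /mobius /den -/c; field.
by rewrite gt_eqF.
Qed.

End boost_action.

End boost_exponential.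

(** * Optimality and uniqueness *)

Section transport.
Context {R : realType} {n : nat}.
Local Notation vol := (@sphere_vol R n).
Implicit Types (phi psi : sphere R n -> R) (T F : sphere R n -> sphere R n).

Lemma measurable_angle_comp d (X : measurableType d) (f g : X -> sphere R n) :
  measurable_fun setT f -> measurable_fun setT g ->
  measurable_fun setT (fun x => angle (f x) (g x)).
Proof.
move=> mf mg.
have ca : {within `[-1, 1 : R], continuous (@acos R)}.
  apply: segment_dec_surj_continuous.
    by move=> x y; rewrite !in_itv /= => x1 y1; rewrite le_acos.
  move=> y; rewrite /= acos1 acosN1 !in_itv /= => y0.
  by exists (cos y); [rewrite /= in_itv /= cos_itv|rewrite cosK].
apply: (measurable_comp (F := [set` `[-1, 1 : R]]) (f := @acos R)) => //.
- by move=> _ [x _ <-]; rewrite /= in_itv /= dotp_sphere_itv.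
- exact: subspace_continuous_measurable_fun.
- apply: measurable_dotp => i.
    exact: (measurableT_comp (measurable_sphere_coord i) mf).
  exact: (measurableT_comp (measurable_sphere_coord i) mg).
Qed.

Lemma integrable_bounded (f : sphere R n -> R) (M : R) :
  measurable_fun setT f -> (forall x, `|f x| <= M) ->
  vol.-integrable setT (EFin \o f).
Proof.
move=> mf fM; apply: measurable_bounded_integrable => //.
  exact: sphere_vol_fin.
exists M; split; first exact: num_real.
by move=> y My x _ /=; apply: le_trans (fM x) _; exact: ltW.
Qed.

(** Both integrals are taken against push-forwards of the volume that agree with [nu] on measurable
    sets; [nu] itself is a bare set function, so these two measures are compared directly. *)
Lemma integral_pushes_to (nu : set (sphere R n) -> \bar R) T T' (psi : sphere R n -> R) M :
  pushes_to vol nu T -> pushes_to vol nu T' ->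
  measurable_fun setT psi -> (forall x, `|psi x| <= M) ->
  (\int[vol]_x (psi (T x))%:E = \int[vol]_x (psi (T' x))%:E)%E.
Proof.
move=> [mT pT] [mT' pT'] mpsi psiM.
have ci F : measurable_fun setT F -> vol.-integrable setT (EFin \o (psi \o F)).
  by move=> mF; apply: (@integrable_bounded _ M) => [|x]; [exact: measurableT_comp|exact: psiM].
have mE : measurable_fun setT (EFin \o psi) by apply/measurable_EFinP.
have I1 := @integral_pushforward _ _ _ _ R T mT vol setT _ mE (ci _ mT) measurableT.
have I2 := @integral_pushforward _ _ _ _ R T' mT' vol setT _ mE (ci _ mT') measurableT.
rewrite !preimage_setT in I1 I2.
rewrite -[LHS]I1 -[RHS]I2.
apply: eq_measure_integral => A mA _.
by transitivity (nu A); [exact: pT|exact/esym/pT'].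
Qed.

(** The easy half of Kantorovich duality: the cost of an admissible [F] is a finite term depending
    only on [nu], plus the integral of [gap F]. For [T] the gap is zero. For another optimal map it
    has integral zero, hence vanishes a.e., and strictness off the graph concludes. *)
Lemma potentials_optimal (nu : set (sphere R n) -> \bar R) T phi psi M :
  (forall F, measurable_fun setT F -> measurable_fun setT (fun x => cost x (F x))) ->
  (forall x y : sphere R n, 0 <= cost x y <= M) ->
  measurable_fun setT phi -> measurable_fun setT psi ->
  (forall x, `|phi x| <= M) -> (forall x, `|psi x| <= M) ->
  (forall x, phi x + psi (T x) = cost x (T x)) ->
  (forall x y, y <> T x -> phi x + psi y < cost x y) ->
  pushes_to vol nu T ->
  optimal_map vol nu T /\
  forall T', optimal_map vol nu T' -> {ae vol, forall x, T' x = T x}.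
Proof.
move=> mcost costM mphi mpsi phiM psiM eqT ltT pT.
have pot_le x y : phi x + psi y <= cost x y.
  by have [->|/ltT/ltW//] := pselect (y = T x); rewrite eqT.
have iphi : vol.-integrable setT (EFin \o phi) by exact: (integrable_bounded mphi phiM).
have ipsi F : measurable_fun setT F -> vol.-integrable setT (EFin \o (psi \o F)).
  by move=> mF; apply: (@integrable_bounded _ M) => [|x]; [exact: measurableT_comp|exact: psiM].
have icost F : measurable_fun setT F -> vol.-integrable setT (fun x => (cost x (F x))%:E).
  move=> mF; apply: (@integrable_bounded (fun x => cost x (F x)) M); first exact: mcost.
  by move=> x; have /andP[c0 cM] := costM x (F x); rewrite ger0_norm.
pose gap F x := cost x (F x) - (phi x + psi (F x)).
have gap0 F x : 0 <= gap F x by rewrite subr_ge0.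
have mgap F : measurable_fun setT F -> measurable_fun setT (gap F).
  move=> mF; apply: measurable_funB; first exact: mcost.
  by apply: measurable_funD => //; exact: measurableT_comp.
have igap F : measurable_fun setT F -> (\int[vol]_x (cost x (F x))%:E =
    \int[vol]_x (phi x)%:E + \int[vol]_x (psi (F x))%:E + \int[vol]_x (gap F x)%:E)%E.
  move=> mF; have iD := integrableD measurableT iphi (ipsi _ mF).
  have iG : vol.-integrable setT (EFin \o gap F).
    rewrite (_ : EFin \o gap F = (fun x => (cost x (F x))%:E) \-
      ((EFin \o phi) \+ (EFin \o (psi \o F))))%E; last by apply/funext => x.
    by apply: integrableB => //; exact: icost.
  rewrite -(integralD measurableT iphi (ipsi _ mF)) -(integralD measurableT iD iG).
  by apply: eq_integral => x _; rewrite /gap /= -!EFinD; congr EFin; ring.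
have ipush F : pushes_to vol nu F ->
    (\int[vol]_x (psi (F x))%:E = \int[vol]_x (psi (T x))%:E)%E.
  by move=> pF; exact: (integral_pushes_to pF pT mpsi psiM).
have fin F : measurable_fun setT F ->
    (\int[vol]_x (phi x)%:E + \int[vol]_x (psi (F x))%:E)%E \is a fin_num.
  move=> mF; rewrite fin_numD; apply/andP; split.
    exact: (integrable_fin_num measurableT iphi).
  exact: (integrable_fin_num measurableT (ipsi _ mF)).
have gapT : (\int[vol]_x (gap T x)%:E = 0)%E.
  by apply: integral0_eq => x _; rewrite /gap eqT subrr.
split.
  split => // F pF; rewrite (igap _ pT.1) (igap _ pF.1) (ipush _ pF) gapT adde0.
  by rewrite leeDl//; apply: integral_ge0 => x _; rewrite lee_fin.
move=> F [pF optF].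
have gapF : (\int[vol]_x (gap F x)%:E = 0)%E.
  have := optF T pT; rewrite (igap _ pT.1) (igap _ pF.1) (ipush _ pF) gapT adde0.
  rewrite -[leRHS]adde0 (leeD2lE _ _ (fin _ pT.1)).
  by move=> le0; apply: le_anti; rewrite le0/=; apply: integral_ge0 => x _; rewrite lee_fin.
have /(ae_eq_integral_abs vol measurableT) : measurable_fun setT (EFin \o gap F).
  by apply/measurable_EFinP; exact: (mgap _ pF.1).
case=> + _.
rewrite (eq_integral (fun x => (gap F x)%:E)); last first.
  by move=> x _ /=; rewrite ger0_norm.
move=> /(_ gapF); apply: filterS => x /(_ I) /= [] gx.
have [//|/ltT] := pselect (F x = T x).
by rewrite -subr_gt0 -/(gap F x) gx ltxx.
Qed.

Lemma boost_optimal (n_ge1 : (1 <= n)%N) (P : 'M[R]_(1 + n.+1)) (C S : R)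
    (e : sphere R n) (nu : set (sphere R n) -> \bar R) :
  0 < C -> C ^+ 2 - S ^+ 2 = 1 ->
  (forall u : 'cV[R]_n.+1, P *m homog u =
    col_mx (C + S * dotp (\val e) u)%:M
           (u + (S + (C - 1) * dotp (\val e) u) *: \val e)) ->
  pushes_to vol nu (act P) ->
  optimal_map vol nu (act P) /\
  forall T', optimal_map vol nu T' -> {ae vol, forall x, T' x = act P x}.
Proof.
move=> C0 CS PE pP.
have [phi [psi [M [mphi mpsi potM potE potlt]]]] := boost_potentials C0 CS.
have costE (x y : sphere R n) : cost x y = angle x y ^+ 2 / 2.
  by rewrite /cost geodesic_distE.
have me : measurable_fun setT (fun x : sphere R n => angle e x).
  exact: measurable_angle_comp.
have mcomp (f : R -> R) : measurable_fun [set` `[0, pi]] f ->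
    measurable_fun setT (fun x : sphere R n => f (angle e x)).
  move=> mf; apply: (measurable_comp (F := [set` `[0, pi]]) (f := f)) => //.
  by move=> _ [x _ <-]; rewrite /= in_itv /= angle_itv.
have pi0 := pi_ge0 R.
(* Cosine bounds become bounds on squares by applying the strict monotonicity of the cosine on
   [[0, pi]] to [c] and [|a - b|]. *)
have cosB_inj (a b c : R) : 0 <= a <= pi -> 0 <= b <= pi -> 0 <= c <= pi ->
    cos c <= cos (a - b) -> (a - b) ^+ 2 <= c ^+ 2 /\
    ((a - b) ^+ 2 = c ^+ 2 <-> cos c = cos (a - b)).
  move=> /andP[a0 a1] /andP[b0 b1] c0.
  have -> : cos (a - b) = cos `|a - b|.
    by case: (ger0P (a - b)) => // _; rewrite cosN.
  have ab : 0 <= `|a - b| <= pi by rewrite normr_ge0 ler_norml; apply/andP; split; lra.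
  rewrite le_cos// => abc; rewrite -[(a - b) ^+ 2]real_normK ?num_real//.
  have /andP[cc _] := c0; rewrite ler_pXn2r ?nnegrE//; split => //; split => [/eqP|].
    by rewrite eqrXn2// => /eqP ->.
  by move=> /(cos_inj _ _) ->//; rewrite in_itv.
have angP x y := cosB_inj _ _ _ (angle_itv e x) (angle_itv e y) (angle_itv x y).
apply: (@potentials_optimal nu (act P) (fun x => phi (angle e x))
  (fun x => psi (angle e x)) (Num.max M (pi ^+ 2))) => //.
- move=> F mF; under eq_fun do rewrite costE.
  by apply: measurable_funM => //; apply: measurable_funX; exact: measurable_angle_comp.
- move=> x y; rewrite costE le_max; have /andP[a0 a1] := angle_itv x y.
  have h : 0 <= angle x y ^+ 2 <= pi ^+ 2 by rewrite sqr_ge0 ler_pXn2r.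
  move: h => /andP[h1 h2]; apply/andP; split; first lra.
  by apply/orP; right; lra.
- exact: mcomp.
- exact: mcomp.
- by move=> x; rewrite le_max (potM _ (angle_itv e x)).1.
- by move=> x; rewrite le_max (potM _ (angle_itv e x)).2.
- move=> x; rewrite (angle_act_boost C0 CS PE) (potE _ (angle_itv e x)) costE.
  rewrite -(angle_act_boost C0 CS PE); congr (_ / _).
  have c0 := dotp_act_boost_cos C0 CS PE x; rewrite -cos_angle in c0.
  have c1 := dotp_le_cos_angleB e x (act P x); rewrite -cos_angle in c1.
  by have [_ /iffRL/(_ c0)] := angP x (act P x) c1.
- move=> x y yT; rewrite costE.
  have yx := dotp_le_cos_angleB e x y; rewrite -cos_angle in yx.
  have [le1 eq1] := angP x y yx.
  (* If the angle of [y] is not the image angle, the potentials are strict. Otherwise [y] lies on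
     the parallel of [act P x], and equality in the distance bound would force [y = act P x]. *)
  have [ya|ya] := eqVneq (angle e y) (boost_angle C S (angle e x)); last first.
    apply: lt_le_trans (potlt _ _ (angle_itv e x) (angle_itv e y) ya) _.
    by rewrite ler_pM2r.
  rewrite ya (potE _ (angle_itv e x)) -ya ltr_pM2r// lt_neqAle le1 andbT.
  apply/negP => /eqP/(iffLR eq1); rewrite cos_angle => xy; apply: yT.
  have yT : angle e y = angle e (act P x) by rewrite (angle_act_boost C0 CS PE).
  have ey : dotp (\val e) (\val y) = dotp (\val e) (\val (act P x)).
    by rewrite -!cos_angle yT.
  have xy' : dotp (\val x) (\val y) = dotp (\val x) (\val (act P x)).
    by rewrite xy yT (dotp_act_boost_cos C0 CS PE).
  (* [act P x] is a combination of [x] and [e], with which [y] and [act P x] have the same inner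
     products. *)
  have dy : dotp (\val y) (\val (act P x)) = 1.
    rewrite -(dotp_sphere (act P x)) !(dotp_act_boost C0 CS PE).
    by rewrite !(dotpC _ (\val x)) !(dotpC _ (\val e)) ey xy'.
  apply: val_inj; apply/eqP; rewrite -subr_eq0 -dotp_eq0.
  rewrite dotpDl !dotpDr !dotpNl !dotpNr !dotp_sphere (dotpC (\val (act P x))) dy.
  by apply/eqP; ring.
Qed.

End transport.

Theorem theorem1 (R : realType) (n : nat) (n_ge1 : (1 <= n)%N)
    (A P : 'M[R]_(1 + n.+1)) (O : 'M[R]_n.+1)
    (GA : lorentz_group0 R n A)
    (expP : exp_boosts R n P) (SO_O : so_group R n O)
    (A_PO : A = P *m so_embed O) :
  polar_factorization (act A) (act P) (act (so_embed O)) /\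
  forall T U : sphere R n -> sphere R n,
    polar_factorization (act A) T U ->
    {ae sphere_vol, forall x, T x = act P x} /\
    {ae sphere_vol, forall x, U x = act (so_embed O) x}.
Proof.
have [OO _] := SO_O.
have [C [S [e [C0 CS PE]]]] := exp_boostsP expP.
set U0 := act (so_embed O).
have UE p : \val (U0 p) = O *m \val p by exact: val_act_so.
have mU : measurable_fun setT U0.
  apply: measurable_sphere => i; under eq_fun do rewrite UE.
  by apply: measurable_mulmx => j; exact: measurable_sphere_coord.
have mP := measurable_act_boost C0 CS PE.
have AE u : act A u = act P (U0 u).
  have [Pu _] := act_boostE C0 CS PE (U0 u).
  apply: act_eq; last first.
    rewrite A_PO -mulmxA (_ : so_embed O *m _ = homog (\val (U0 u))); first exact: Pu.
    by rewrite UE /so_embed /homog mul_block_col !mul0mx mulmx1 addr0 add0r.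
  by rewrite gt_eqF//; apply: (mobius_den_gt0 C0 CS); exact: dotp_sphere_itv.
have volU (B : set (sphere R n)) : measurable B -> sphere_vol (U0 @^-1` B) = sphere_vol B.
  exact: sphere_vol_orthogonal OO UE.
(* As [U0] preserves the volume, the preimage of [B] by [act P] has the volume of its preimage by
   [act P] after [U0], which is the preimage by [act A]. *)
have pP : pushes_to sphere_vol (pushforward sphere_vol (act A)) (act P).
  split => // B mB; rewrite /pushforward -[LHS]volU; last exact: measurable_fun_pre.
  by congr sphere_vol; apply/seteqP; split => x /=; rewrite AE.
have [optP uniqP] := boost_optimal n_ge1 C0 CS PE pP.
split; first by split => //; apply: aeW => x; exact: AE.
move=> T U [optT [mU' pU] SE].
have TP := uniqP T optT; split => //.
have TPU : {ae sphere_vol, forall x, T (U x) = act P (U x)}.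
  have [N [mN N0 TN]] := TP.
  exists (U @^-1` N); split; first exact: measurable_fun_pre.
    by have := pU N mN; rewrite /pushforward => ->.
  by move=> x h; apply: TN.
apply: filterS2 SE TPU => x; rewrite AE => <- /(act_boost_inj C0 CS PE).
exact: esym.
Qed.
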